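(* Let $\phi\colon\Gamma\to X$ be a partial flow on a metric space $X$ and let $\Lambda\subset X$ be an isolated set of $\phi$. Then $\Lambda$ admits an isolating universe: a flow $\psi$ on a compact metric space $Y$ as in the context, with the properties (1)–(4) listed there. Moreover, this isolating universe can be chosen so that, for $\psi$, the set $\Lambda_\alpha=\{\alpha\}\cup\Lambda\cup W^s(\Lambda)$ is a repeller, the set $\Lambda_\omega=\{\omega\}\cup\Lambda\cup W^u(\Lambda)$ is an attractor, and $\Lambda=\Lambda_\alpha\cap\Lambda_\omega$.
   Context: A partial flow on a metric space $X$ is a continuous map $\phi\colon\Gamma\to X$, $(t,x)\mapsto\phi_t(x)$, where $\Gamma\subset\mathbb{R}\times X$ is open. It is required to satisfy the following: (i) for every $x$ the set $\Gamma_x=\{t:(t,x)\in\Gamma\}$ is connected; (ii) $0\in\Gamma_x$ and $\Gamma_{\phi_t(x)}=\Gamma_x-t$ for $(t,x)\in\Gamma$; (iii) $\phi_0(x)=x$ and $\phi_s(\phi_t(x))=\phi_{s+t}(x)$ whenever $s,t,s+t\in\Gamma_x$. A flow is a partial flow with $\Gamma=\mathbb{R}\times X$. A set $\Lambda$ is $\phi$-invariant if $x\in\Lambda$ and $t\in\Gamma_x$ imply $\phi_t(x)\in\Lambda$. A $\phi$-invariant set $\Lambda$ is an isolated set if there is a compact neighborhood $N$ of $\Lambda$ (an isolating neighborhood) such that $\phi_{\Gamma_x}(x)\subseteq N$ implies $x\in\Lambda$. An isolated set $\Lambda$ is an attractor if it has an isolating neighborhood $N$ such that every $x\in N\setminus\Lambda$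 satisfies $\phi_t(x)\notin N$ for some $t<0$. It is a repeller if it is an attractor for the time-reversed flow. Given an isolated set $\Lambda$ with isolating neighborhood $N$, a flow $\psi$ on a compact metric space $Y$ is an isolating universe of $\Lambda$ if the following hold. (1) There is a homeomorphism $h\colon N\to M\subset Y$ conjugating $\phi$ restricted to $N$ with $\psi$ restricted to $M$, i.e. $h(\phi_t(x))=\psi_t(h(x))$ whenever $\phi_s(x)\in N$ for all $s$ between $0$ and $t$. Via $h$ one identifies $N$ with $M$ and $\Lambda$ with $h(\Lambda)$. (2) There are two fixed points $\alpha\neq\omega$ of $\psi$ not in $M$. (3) For every $x\neq\alpha$, $\psi_t(x)$ converges as $t\to+\infty$ either to $h(\Lambda)$ or to $\omega$. (4) For every $x\neq\omega$, $\psi_t(x)$ converges as $t\to-\infty$ either to $h(\Lambda)$ or to $\alpha$. Finally, $W^s(\Lambda)=\{x\in Y:\operatorname{dist}(\psi_t(x),\Lambda)\to0 \text{ as } t\to+\infty\}$ and $W^u(\Lambda)=\{x\in Y:\operatorname{dist}(\psi_t(x),\Lambda)\to0 \text{ as } t\to-\infty\}$. *)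

(* Defs.v *)
From Stdlib Require Export Reals List.
Open Scope R_scope.

Definition is_metric {X : Type} (d : X -> X -> R) : Prop :=
  (forall x y, 0 <= d x y) /\
  (forall x y, d x y = 0 <-> x = y) /\
  (forall x y, d x y = d y x) /\
  (forall x y z, d x z <= d x y + d y z).

Definition is_open {X : Type} (d : X -> X -> R) (U : X -> Prop) : Prop :=
  forall x, U x -> exists e, 0 < e /\ forall y, d x y < e -> U y.

Definition is_open_RX {X : Type} (d : X -> X -> R) (G : R -> X -> Prop) : Prop :=
  forall t x, G t x -> exists e, 0 < e /\
    forall s y, Rabs (s - t) < e -> d x y < e -> G s y.

Definition is_compact {X : Type} (d : X -> X -> R) (K : X -> Prop) : Prop :=
  forall (I : Type) (U : I -> X -> Prop),
    (forall i, is_open d (U i)) ->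
    (forall x, K x -> exists i, U i x) ->
    exists l : list I, forall x, K x -> exists i, In i l /\ U i x.

Definition is_nbhd {X : Type} (d : X -> X -> R) (A N : X -> Prop) : Prop :=
  exists U, is_open d U /\ (forall x, A x -> U x) /\ (forall x, U x -> N x).

(* Partial flow phi : Gamma -> X; phi is a total function whose values
   outside Gamma are irrelevant.  Gamma t x means (t,x) in Gamma. *)
Definition is_partial_flow {X : Type} (d : X -> X -> R)
    (Gamma : R -> X -> Prop) (phi : R -> X -> X) : Prop :=
  is_open_RX d Gamma /\
  (forall t x, Gamma t x -> forall eps, 0 < eps -> exists delta, 0 < delta /\
     forall s y, Gamma s y -> Rabs (s - t) < delta -> d x y < delta ->
       d (phi t x) (phi s y) < eps) /\
  (forall x a b c, a <= c <= b -> Gamma a x -> Gamma b x -> Gamma c x) /\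
  (forall x, Gamma 0 x) /\
  (forall t x, Gamma t x -> forall s, Gamma s (phi t x) <-> Gamma (s + t) x) /\
  (forall x, phi 0 x = x) /\
  (forall s t x, Gamma s x -> Gamma t x -> Gamma (s + t) x ->
     phi s (phi t x) = phi (s + t) x).

Definition is_flow {Y : Type} (d : Y -> Y -> R) (psi : R -> Y -> Y) : Prop :=
  is_partial_flow d (fun _ _ => True) psi.

Definition is_invariant {X : Type} (Gamma : R -> X -> Prop) (phi : R -> X -> X)
    (L : X -> Prop) : Prop :=
  forall x t, L x -> Gamma t x -> L (phi t x).

Definition isolating_nbhd {X : Type} (d : X -> X -> R)
    (Gamma : R -> X -> Prop) (phi : R -> X -> X) (L N : X -> Prop) : Prop :=
  is_compact d N /\ is_nbhd d L N /\
  forall x, (forall t, Gamma t x -> N (phi t x)) -> L x.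

Definition is_isolated {X : Type} (d : X -> X -> R)
    (Gamma : R -> X -> Prop) (phi : R -> X -> X) (L : X -> Prop) : Prop :=
  is_invariant Gamma phi L /\ exists N, isolating_nbhd d Gamma phi L N.

Definition is_attractor {X : Type} (d : X -> X -> R)
    (Gamma : R -> X -> Prop) (phi : R -> X -> X) (L : X -> Prop) : Prop :=
  is_invariant Gamma phi L /\
  exists N, isolating_nbhd d Gamma phi L N /\
    forall x, N x -> ~ L x -> exists t, t < 0 /\ Gamma t x /\ ~ N (phi t x).

Definition is_repeller {X : Type} (d : X -> X -> R)
    (Gamma : R -> X -> Prop) (phi : R -> X -> X) (L : X -> Prop) : Prop :=
  is_attractor d (fun t x => Gamma (- t) x) (fun t x => phi (- t) x) L.

Definition tends_to_set_pinf {Y : Type} (d : Y -> Y -> R) (f : R -> Y)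
    (A : Y -> Prop) : Prop :=
  forall eps, 0 < eps -> exists T, forall t, T <= t ->
    exists z, A z /\ d (f t) z < eps.

Definition tends_to_set_minf {Y : Type} (d : Y -> Y -> R) (f : R -> Y)
    (A : Y -> Prop) : Prop :=
  forall eps, 0 < eps -> exists T, forall t, t <= T ->
    exists z, A z /\ d (f t) z < eps.

Definition tends_to_pinf {Y : Type} (d : Y -> Y -> R) (f : R -> Y) (p : Y) : Prop :=
  forall eps, 0 < eps -> exists T, forall t, T <= t -> d (f t) p < eps.

Definition tends_to_minf {Y : Type} (d : Y -> Y -> R) (f : R -> Y) (p : Y) : Prop :=
  forall eps, 0 < eps -> exists T, forall t, t <= T -> d (f t) p < eps.

Definition Ws {Y : Type} (d : Y -> Y -> R) (psi : R -> Y -> Y) (A : Y -> Prop)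
    (y : Y) : Prop := tends_to_set_pinf d (fun t => psi t y) A.
Definition Wu {Y : Type} (d : Y -> Y -> R) (psi : R -> Y -> Y) (A : Y -> Prop)
    (y : Y) : Prop := tends_to_set_minf d (fun t => psi t y) A.

Definition isolating_universe {X Y : Type} (d : X -> X -> R)
    (Gamma : R -> X -> Prop) (phi : R -> X -> X) (L N : X -> Prop)
    (dY : Y -> Y -> R) (psi : R -> Y -> Y) (h : X -> Y) (alpha omega : Y) : Prop :=
  let hL := fun y => exists x, L x /\ h x = y in
  is_metric dY /\ is_compact dY (fun _ => True) /\ is_flow dY psi /\
  (* (1) h : N -> M = h(N) homeomorphism conjugating phi and psi *)
  (forall x x', N x -> N x' -> h x = h x' -> x = x') /\
  (forall x, N x -> forall eps, 0 < eps -> exists delta, 0 < delta /\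
     forall x', N x' -> d x x' < delta -> dY (h x) (h x') < eps) /\
  (forall x, N x -> forall eps, 0 < eps -> exists delta, 0 < delta /\
     forall x', N x' -> dY (h x) (h x') < delta -> d x x' < eps) /\
  (forall x t, N x ->
     (forall s, Rmin 0 t <= s <= Rmax 0 t -> Gamma s x /\ N (phi s x)) ->
     h (phi t x) = psi t (h x)) /\
  alpha <> omega /\
  (forall t, psi t alpha = alpha) /\ (forall t, psi t omega = omega) /\
  (forall x, N x -> h x <> alpha) /\ (forall x, N x -> h x <> omega) /\
  (forall y, y <> alpha ->
     tends_to_set_pinf dY (fun t => psi t y) hL \/
     tends_to_pinf dY (fun t => psi t y) omega) /\
  (forall y, y <> omega ->
     tends_to_set_minf dY (fun t => psi t y) hL \/
     tends_to_minf dY (fun t => psi t y) alpha).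

(* Main.v *)
Require Import Defs.
From Stdlib Require Import Lra Lia ClassicalEpsilon ProofIrrelevance.
From Coquelicot Require Import Coquelicot.

(** The conjugacy with [phi] is only required inside the isolating neighborhood, so the flow may be
    altered outside it. Slow [phi] down by a cut-off that is 1 near a small isolating neighborhood
    [N0] and vanishes outside a larger compact neighborhood [N]: this gives a complete flow [theta]
    on [N]. On [N x [-1,1]], with each end collapsed to a point ([alpha] at level -1, [omega] at
    level 1), let the base move by [theta] and the level [m] by [m' = (1 - |m|) (|m| + g x)], where
    [g >= 0] vanishes exactly on [N0]; embed [N0] at level 0. The level never decreases, and it is
    constant along an orbit only at the two ends or if [m = 0] and the whole orbit stays in [N0],
    that is, on [L]. LaSalle's principle then yields all convergence statements, and
    [m >= -1/2] and [m <= 1/2] are isolating neighborhoods of the attractor and the repeller. *)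

(** * Scalar differential equations *)

(** The obstacle is regularity. Since [phi] is merely continuous, a cut-off evaluated along an orbit
    need not be Lipschitz in time, and the equation of the slowed clock could have several
    solutions. Along each orbit the cut-off, capped at 1, is therefore replaced by its largest
    [K]-Lipschitz minorant. The value of this minorant at a time depends only on times less than
    [/ K] away, so it is still 1 on [N0] as soon as the cut-off is at least 1 on all orbit pieces of
    duration [/ K] around [N0]. Clock and level then both solve globally Lipschitz scalar equations:
    solutions exist for all time, and uniqueness keeps a clock from leaving the domain and a level
    from reaching an end.

    Isolation enters at a single point: an orbit resting at level 0 stays in [N0], where the clock
    runs at full speed, so it is a complete orbit of [phi] inside [N]. *)

Definition cont (f : R -> R) : Prop :=
  forall t eps, 0 < eps -> exists del, 0 < del /\
    forall s, Rabs (s - t) < del -> Rabs (f s - f t) < eps.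

Lemma cont_continuity_pt (f : R -> R) (t : R) : cont f -> continuity_pt f t.
Proof.
intros Hf; apply continuity_pt_locally; intros eps.
destruct (Hf t eps (cond_pos eps)) as [del [Hd H]].
exists (mkposreal del Hd); intros s Hs; apply H, Hs.
Qed.

Lemma cont_continuous (f : R -> R) (t : R) : cont f -> continuous f t.
Proof.
intros Hf; apply continuity_pt_filterlim; apply cont_continuity_pt, Hf.
Qed.

Lemma is_derive_cst (c t : R) : is_derive (fun _ => c) t 0.
Proof. apply (is_derive_const (V := R_NormedModule)). Qed.

Lemma derive_cont (f df : R -> R) :
  (forall t, is_derive f t (df t)) -> cont f.
Proof.
intros Hf t eps He.
assert (Hc : continuity_pt f t).
{ apply continuity_pt_filterlim.
  apply (ex_derive_continuous (V := R_NormedModule)).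
  exists (df t); apply Hf. }
rewrite continuity_pt_locally in Hc.
destruct (Hc (mkposreal eps He)) as [del H].
exists del; split; [apply cond_pos|]; intros s Hs; apply (H s Hs).
Qed.

Lemma derive_nonneg_le (f df : R -> R) (a b : R) :
  a <= b -> (forall t, is_derive f t (df t)) ->
  (forall t, a <= t <= b -> 0 <= df t) -> f a <= f b.
Proof.
intros Hab Hf Hdf.
destruct (MVT_gen f a b df) as [c [Hc E]].
- intros x _; apply Hf.
- intros x _; apply cont_continuity_pt, (derive_cont f df Hf).
- rewrite Rmin_left, Rmax_right in Hc by lra.
  assert (0 <= df c * (b - a)); [|lra].
  apply Rmult_le_pos; [apply Hdf; lra|lra].
Qed.

(** Both [Q - D] and [Q + D] are nondecreasing and vanish at 0; the absolute value of [Q t] covers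
    negative times. *)
Lemma derive_dominated (D dD Q dQ : R -> R) (t : R) :
  (forall s, is_derive D s (dD s)) -> (forall s, is_derive Q s (dQ s)) ->
  D 0 = 0 -> Q 0 = 0 -> (forall s, Rabs (dD s) <= dQ s) ->
  Rabs (D t) <= Rabs (Q t).
Proof.
intros HD HQ D0 Q0 Hd.
assert (H1 : forall s, is_derive (fun s => Q s - D s) s (dQ s - dD s)).
{ intros s; apply (is_derive_minus (V := R_NormedModule)); auto. }
assert (H2 : forall s, is_derive (fun s => Q s + D s) s (dQ s + dD s)).
{ intros s; apply (is_derive_plus (V := R_NormedModule)); auto. }
assert (Hn : forall s, 0 <= dQ s - dD s /\ 0 <= dQ s + dD s).
{ intros s; specialize (Hd s); apply Rabs_le_between in Hd; lra. }
destruct (Rle_dec 0 t) as [Ht|Ht].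
- assert (A1 := derive_nonneg_le _ _ 0 t Ht H1 (fun s _ => proj1 (Hn s))).
  assert (A2 := derive_nonneg_le _ _ 0 t Ht H2 (fun s _ => proj2 (Hn s))).
  simpl in *. rewrite (Rabs_right (Q t)) by lra. apply Rabs_le; lra.
- assert (A1 := derive_nonneg_le _ _ t 0 ltac:(lra) H1 (fun s _ => proj1 (Hn s))).
  assert (A2 := derive_nonneg_le _ _ t 0 ltac:(lra) H2 (fun s _ => proj2 (Hn s))).
  simpl in *. rewrite (Rabs_left1 (Q t)) by lra. apply Rabs_le; lra.
Qed.

Lemma RInt_derive (f : R -> R) (t : R) :
  cont f -> is_derive (fun t => RInt f 0 t) t (f t).
Proof.
intros Hf; apply (is_derive_RInt (V := R_NormedModule) f _ 0).
- exists (mkposreal 1 Rlt_0_1); intros y _; apply (RInt_correct (V := R_CompleteNormedModule)).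
  apply (ex_RInt_continuous (V := R_CompleteNormedModule)).
  intros z _; apply cont_continuous, Hf.
- apply cont_continuous, Hf.
Qed.

Lemma cont_lipschitz_comp (F : R -> R -> R) (K : R) (f : R -> R) :
  0 < K -> (forall t u v, Rabs (F t u - F t v) <= K * Rabs (u - v)) ->
  (forall u, cont (fun t => F t u)) -> cont f -> cont (fun t => F t (f t)).
Proof.
intros HK HL HF Hf t eps He.
destruct (HF (f t) t (eps / 2) ltac:(lra)) as [d1 [Hd1 H1]].
assert (He' : 0 < eps / (2 * K)) by (apply Rdiv_lt_0_compat; lra).
destruct (Hf t _ He') as [d2 [Hd2 H2]].
exists (Rmin d1 d2); split; [apply Rmin_pos; auto|].
intros s Hs.
specialize (H1 s (Rlt_le_trans _ _ _ Hs (Rmin_l _ _))).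
specialize (H2 s (Rlt_le_trans _ _ _ Hs (Rmin_r _ _))).
replace (F s (f s) - F t (f t))
  with ((F s (f s) - F s (f t)) + (F s (f t) - F t (f t))) by ring.
eapply Rle_lt_trans; [apply Rabs_triang|].
assert (H3 := HL s (f s) (f t)).
assert (K * Rabs (f s - f t) < K * (eps / (2 * K)))
  by (apply Rmult_lt_compat_l; auto).
replace (K * (eps / (2 * K))) with (eps / 2) in H by (field; lra).
simpl in H1. lra.
Qed.

Fixpoint picard_iter (F : R -> R -> R) (u0 : R) (n : nat) (t : R) : R :=
  match n with
  | O => u0
  | S n => u0 + RInt (fun s => F s (picard_iter F u0 n s)) 0 t
  end.

(** The weight is [2 cosh (2 K t)] and its primitive [sinh (2 K t) / K]: integrating gains the
    factor [1 / (2 K)] that beats the Lipschitz constant. *)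
Lemma is_derive_sinh2 (K t : R) : 0 < K ->
  is_derive (fun t => (exp (2 * K * t) - exp (- (2 * K * t))) / (2 * K)) t
            (exp (2 * K * t) + exp (- (2 * K * t))).
Proof. intros HK; auto_derive; [auto|field; lra]. Qed.

Lemma cont_const_plus_derive (u0 : R) (f df : R -> R) :
  (forall t, is_derive f t (df t)) ->
  forall t, is_derive (fun t => u0 + f t) t (df t).
Proof.
intros Hf t; evar_last.
- apply (is_derive_plus (V := R_NormedModule)); [apply is_derive_const|apply Hf].
- apply Rplus_0_l.
Qed.

(* Picard iteration on the whole line at once: in the norm weighted by
   [exp (2 K t) + exp (- 2 K t)] the iteration contracts by the factor 1/2. *)
Lemma picard_lindelof (F : R -> R -> R) (K B u0 : R) :
  0 < K -> (forall t u v, Rabs (F t u - F t v) <= K * Rabs (u - v)) ->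
  (forall u, cont (fun t => F t u)) -> (forall t, Rabs (F t u0) <= B) ->
  exists f, f 0 = u0 /\ forall t, is_derive f t (F t (f t)).
Proof.
intros HK HL HF HB.
set (wt := fun t => exp (2 * K * t) + exp (- (2 * K * t))).
set (Q := fun t => (exp (2 * K * t) - exp (- (2 * K * t))) / (2 * K)).
assert (HQ : forall t, is_derive Q t (wt t)) by (intros; apply is_derive_sinh2, HK).
assert (Q0 : Q 0 = 0).
{ unfold Q; replace (2 * K * 0) with 0 by ring; rewrite Ropp_0; field; lra. }
assert (HSc : cont wt).
{ apply (derive_cont wt (fun t => 2 * K * (exp (2 * K * t) - exp (- (2 * K * t))))).
  intros t; unfold wt; auto_derive; [auto|ring]. }
assert (HS : forall t, 0 < wt t).
{ intros t; unfold wt. assert (A := exp_pos (2*K*t)). assert (A' := exp_pos (-(2*K*t))). lra. }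
(* This is the contraction factor 1/2. *)
assert (HQS : forall t, K * Rabs (Q t) <= wt t / 2).
{ intros t; unfold Q, wt.
  assert (A := exp_pos (2*K*t)). assert (A' := exp_pos (-(2*K*t))).
  rewrite Rabs_div, (Rabs_right (2 * K)) by lra.
  assert (Rabs (exp (2 * K * t) - exp (- (2 * K * t))) <= exp (2 * K * t) + exp (- (2 * K * t)))
    by (apply Rabs_le; lra).
  replace (K * (Rabs (exp (2 * K * t) - exp (- (2 * K * t))) / (2 * K)))
    with (Rabs (exp (2 * K * t) - exp (- (2 * K * t))) / 2) by (field; lra).
  lra. }
set (u := picard_iter F u0).
assert (Hc : forall n, cont (u n)).
{ induction n as [|n IH].
  - intros t eps He; exists 1; split; [lra|]; intros s _; simpl.
    rewrite Rminus_diag, Rabs_R0; auto.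
  - eapply derive_cont; apply cont_const_plus_derive; intros t; apply RInt_derive.
    apply (cont_lipschitz_comp F K); auto. }
assert (HFc : forall n, cont (fun t => F t (u n t)))
  by (intros n; apply (cont_lipschitz_comp F K); auto).
assert (Hd : forall n t, is_derive (u (S n)) t (F t (u n t))).
{ intros n; apply (cont_const_plus_derive u0 (fun t => RInt (fun s => F s (u n s)) 0 t)).
  intros t; apply (RInt_derive (fun s => F s (u n s))); auto. }
assert (Hu0 : forall n, u n 0 = u0).
{ intros [|n]; [reflexivity|].
  change (u0 + RInt (fun s => F s (u n s)) 0 0 = u0).
  rewrite RInt_point; apply Rplus_0_r. }
assert (HBnn : 0 <= B) by (eapply Rle_trans; [apply Rabs_pos|apply (HB 0)]).
set (C := B / K).
assert (HC : 0 <= C) by (apply Rdiv_le_0_compat; lra).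
assert (Hstep : forall n t, Rabs (u (S n) t - u n t) <= C * (/2)^n * wt t).
{ induction n as [|n IH]; intros t.
  - replace (u 1%nat t - u 0%nat t) with (u 1%nat t - u0) by reflexivity.
    assert (A : Rabs (u 1%nat t - u0) <= Rabs (B * Q t)).
    { apply (derive_dominated (fun t => u 1%nat t - u0) (fun t => F t u0 - 0)
        (fun t => B * Q t) (fun t => B * wt t)).
      - intros s; apply (is_derive_minus (V := R_NormedModule)); [apply (Hd 0%nat)|apply is_derive_cst].
      - intros s; apply is_derive_scal, HQ.
      - rewrite Hu0; ring.
      - rewrite Q0; ring.
      - intros s; rewrite Rminus_0_r.
        (* A weight of at least 1 turns the bound [B] into the weighted bound [B * wt]. *)
        assert (1 <= wt s).
        { unfold wt. destruct (Rle_dec 0 s).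
          - assert (A := exp_ineq1_le (2*K*s)). assert (A' := exp_pos (-(2*K*s))).
            assert (0 <= 2 * K * s) by (apply Rmult_le_pos; lra). lra.
          - assert (A := exp_ineq1_le (-(2*K*s))). assert (A' := exp_pos ((2*K*s))).
            assert (0 <= 2 * K * - s) by (apply Rmult_le_pos; lra). lra. }
        specialize (HB s). nra. }
    rewrite Rabs_mult, (Rabs_right B) in A by lra.
    specialize (HQS t). unfold C; simpl. rewrite Rmult_1_r.
    apply Rle_trans with (1 := A).
    replace (B * Rabs (Q t)) with (B / K * (K * Rabs (Q t))) by (field; lra).
    apply Rmult_le_compat_l; auto. specialize (HS t); lra.
  - assert (A : Rabs (u (S (S n)) t - u (S n) t)
                <= Rabs (K * C * (/2)^n * Q t)).
    { apply (derive_dominated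
        (fun t => u (S (S n)) t - u (S n) t)
        (fun t => F t (u (S n) t) - F t (u n t))
        (fun t => K * C * (/2)^n * Q t) (fun t => K * C * (/2)^n * wt t)).
      - intros s; apply (is_derive_minus (V := R_NormedModule)); apply Hd.
      - intros s; apply is_derive_scal, HQ.
      - rewrite !Hu0; ring.
      - rewrite Q0; ring.
      - intros s; eapply Rle_trans; [apply HL|].
        replace (K * C * (/2)^n * wt s) with (K * (C * (/2)^n * wt s)) by ring.
        apply Rmult_le_compat_l; [lra|apply IH]. }
    apply Rle_trans with (1 := A).
    assert (P : 0 < (/2)^n) by (apply pow_lt; lra).
    rewrite Rabs_mult, Rabs_right.
    + replace (K * C * (/2)^n * Rabs (Q t)) with (C * (/2)^n * (K * Rabs (Q t))) by ring.
      replace (C * (/2) ^ S n * wt t) with (C * (/2)^n * (wt t / 2)) by (simpl; field).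
      apply Rmult_le_compat_l; [apply Rmult_le_pos; lra|apply HQS].
    + apply Rle_ge; apply Rmult_le_pos; [apply Rmult_le_pos; lra|lra]. }
(* The geometric sum in closed form, so that each induction step telescopes exactly. *)
assert (Htele : forall n k t,
  Rabs (u (n + k)%nat t - u n t) <= 2 * C * ((/2)^n - (/2)^(n + k)) * wt t).
{ intros n; induction k as [|k IH]; intros t.
  - rewrite Nat.add_0_r, !Rminus_diag, Rabs_R0; lra.
  - rewrite Nat.add_succ_r.
    replace (u (S (n + k)) t - u n t) with
      ((u (S (n + k)) t - u (n + k)%nat t) + (u (n + k)%nat t - u n t)) by ring.
    eapply Rle_trans; [apply Rabs_triang|].
    specialize (IH t); assert (A := Hstep (n + k)%nat t); simpl.
    nra. }
assert (Hbd : forall n k t, Rabs (u (n + k)%nat t - u n t) <= 2 * C * (/2)^n * wt t).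
{ intros n k t; eapply Rle_trans; [apply Htele|].
  apply Rmult_le_compat_r; [left; apply HS|].
  apply Rmult_le_compat_l; [lra|].
  assert (P : 0 < (/2)^(n+k)) by (apply pow_lt; lra). lra. }
assert (Hsmall : forall M eps, 0 <= M -> 0 < eps -> exists n, 2 * C * (/2)^n * M < eps).
{ intros M eps HM He.
  destruct (pow_lt_1_zero (/2) ltac:(rewrite Rabs_right; lra) (eps / (2 * C * M + 1)))
    as [n Hn].
  - apply Rdiv_lt_0_compat; [auto|]. assert (0 <= C * M) by (apply Rmult_le_pos; auto). lra.
  - exists n; specialize (Hn n (le_n n)).
    assert (P : 0 < (/2)^n) by (apply pow_lt; lra). rewrite Rabs_right in Hn by lra.
    assert (HCM : 0 <= C * M) by (apply Rmult_le_pos; auto).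
    apply Rlt_div_r in Hn; [|lra]. nra. }
assert (Hlim : forall t, { l | is_lim_seq (fun n => u n t) (Finite l) }).
{ intros t; apply constructive_indefinite_description.
  apply ex_lim_seq_cauchy_corr; intros eps.
  destruct (Hsmall (wt t) (eps / 2)) as [N HN]; [left; apply HS|destruct eps; simpl; lra|].
  exists N; intros n m Hn Hm.
  replace n with (N + (n - N))%nat by lia. replace m with (N + (m - N))%nat by lia.
  assert (A := Hbd N (n - N)%nat t). assert (A' := Hbd N (m - N)%nat t).
  apply Rabs_le_between in A; apply Rabs_le_between in A'.
  apply Rabs_def1; lra. }
set (f := fun t => proj1_sig (Hlim t)).
assert (Hf : forall t, is_lim_seq (fun n => u n t) (f t))
  by (intros t; apply (proj2_sig (Hlim t))).
assert (Hfu : forall n t, Rabs (f t - u n t) <= 2 * C * (/2)^n * wt t).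
{ intros n t.
  apply (is_lim_seq_le (fun k => Rabs (u (k + n)%nat t - u n t))
           (fun _ => 2 * C * (/2)^n * wt t) (Finite (Rabs (f t - u n t))) (Finite _)).
  - intros k; rewrite Nat.add_comm; apply Hbd.
  - apply (is_lim_seq_abs _ (Finite (f t - u n t))).
    apply is_lim_seq_minus'; [|apply is_lim_seq_const].
    apply (is_lim_seq_incr_n (fun k => u k t)), Hf.
  - apply is_lim_seq_const. }
assert (Hfc : cont f).
(* Near [t] the weight is at most [wt t + 1], so the convergence is locally uniform. *)
{ intros t eps He.
  destruct (HSc t 1 ltac:(lra)) as [d1 [Hd1 H1]].
  assert (St := HS t).
  destruct (Hsmall (wt t + 1) (eps / 3)) as [n Hn]; [lra|lra|].
  destruct (Hc n t (eps / 3) ltac:(lra)) as [d2 [Hd2 H2]].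
  exists (Rmin d1 d2); split; [apply Rmin_pos; auto|]; intros s Hs.
  specialize (H1 s (Rlt_le_trans _ _ _ Hs (Rmin_l _ _))).
  specialize (H2 s (Rlt_le_trans _ _ _ Hs (Rmin_r _ _))).
  apply Rabs_def2 in H1; apply Rabs_def2 in H2.
  assert (P : 0 <= 2 * C * (/2)^n).
  { apply Rmult_le_pos; [lra|]. apply pow_le; lra. }
  assert (A := Hfu n t); assert (A' := Hfu n s).
  assert (2 * C * (/2)^n * wt t <= 2 * C * (/2)^n * (wt t + 1)) by (apply Rmult_le_compat_l; lra).
  assert (2 * C * (/2)^n * wt s <= 2 * C * (/2)^n * (wt t + 1)) by (apply Rmult_le_compat_l; lra).
  apply Rabs_le_between in A; apply Rabs_le_between in A'.
  apply Rabs_def1; lra. }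
assert (HFf : cont (fun t => F t (f t))) by (apply (cont_lipschitz_comp F K); auto).
assert (HI : forall t, is_derive (fun t => u0 + RInt (fun s => F s (f s)) 0 t) t (F t (f t))).
{ apply cont_const_plus_derive; intros t; apply (RInt_derive (fun s => F s (f s))); auto. }
exists f; split.
- apply Rbar_finite_eq.
  rewrite <- (is_lim_seq_unique _ _ (Hf 0)).
  rewrite (Lim_seq_ext _ (fun _ => u0)) by apply Hu0.
  apply Lim_seq_const.
- intros t; apply is_derive_ext with (2 := HI t); clear t; intros t.
  (* [f] and its Picard image are both close to the same iterate [u (S n)], hence equal. *)
  assert (A : forall n, Rabs (u0 + RInt (fun s => F s (f s)) 0 t - u (S n) t)
                        <= 2 * C * (/2)^n * wt t).
  { intros n. eapply Rle_trans.
    - apply (derive_dominated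
        (fun t => u0 + RInt (fun s => F s (f s)) 0 t - u (S n) t)
        (fun t => F t (f t) - F t (u n t))
        (fun t => 2 * K * C * (/2)^n * Q t) (fun t => 2 * K * C * (/2)^n * wt t)).
      + intros s; apply (is_derive_minus (V := R_NormedModule)); [apply HI|apply Hd].
      + intros s; apply is_derive_scal, HQ.
      + rewrite Hu0, RInt_point; unfold zero; simpl; ring.
      + rewrite Q0; ring.
      + intros s; eapply Rle_trans; [apply HL|].
        replace (2 * K * C * (/2)^n * wt s) with (K * (2 * C * (/2)^n * wt s)) by ring.
        apply Rmult_le_compat_l; [lra|apply Hfu].
    - assert (P : 0 < (/2)^n) by (apply pow_lt; lra).
      rewrite Rabs_mult, Rabs_right.
      + replace (2 * K * C * (/2)^n * Rabs (Q t)) with (2 * C * (/2)^n * (K * Rabs (Q t))) by ring.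
        apply Rmult_le_compat_l; [apply Rmult_le_pos; lra|].
        specialize (HQS t); specialize (HS t); lra.
      + assert (0 <= K * C) by (apply Rmult_le_pos; lra).
        apply Rle_ge, Rmult_le_pos; lra. }
  apply cond_eq; intros eps He.
  destruct (Hsmall (wt t) (eps / 2)) as [n Hn]; [left; apply HS|lra|].
  specialize (A n); assert (A' := Hfu (S n) t).
  assert (2 * C * (/2)^(S n) * wt t <= 2 * C * (/2)^n * wt t).
  { apply Rmult_le_compat_r; [left; apply HS|]. simpl.
    assert (P : 0 < (/2)^n) by (apply pow_lt; lra).
    apply Rmult_le_compat_l; lra. }
  apply Rabs_le_between in A; apply Rabs_le_between in A'.
  apply Rabs_def1; lra.
Qed.

(** The square is differentiable where the absolute value is not, and adding [eta^2] makes the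
    inequality homogeneous: [V = (f - g)^2 + eta^2] satisfies [|V'| <= 3 K V] because
    [2 x eta <= x^2 + eta^2] and [1 <= K]. *)
Lemma gronwall (f g F G : R -> R) (K eta t : R) :
  (forall s, is_derive f s (F s)) -> (forall s, is_derive g s (G s)) -> 1 <= K ->
  (forall s, Rmin 0 t <= s <= Rmax 0 t ->
     Rabs (F s - G s) <= K * Rabs (f s - g s) + eta) ->
  (f t - g t)^2 + eta^2 <= exp (3 * K * Rabs t) * ((f 0 - g 0)^2 + eta^2).
Proof.
intros Hf Hg HK HFG.
assert (Hb : forall s, Rmin 0 t <= s <= Rmax 0 t ->
  Rabs (2 * (f s - g s) * (F s - G s)) <= 3 * K * ((f s - g s)^2 + eta^2)).
{ intros s Hs; specialize (HFG s Hs).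
  rewrite !Rabs_mult, (Rabs_right 2) by lra.
  assert (A := Rabs_pos (f s - g s)).
  rewrite <- (pow2_abs (f s - g s)).
  set (x := Rabs (f s - g s)) in *. set (y := Rabs (F s - G s)) in *.
  assert (2 * x * y <= 2 * x * (K * x + eta)) by (apply Rmult_le_compat_l; lra).
  assert (0 <= (x - eta)^2) by apply pow2_ge_0.
  assert (0 <= x ^ 2) by apply pow2_ge_0. assert (0 <= eta^2) by apply pow2_ge_0.
  nra. }
assert (HV : forall k s, is_derive (fun s => ((f s - g s)^2 + eta^2) * exp (k * s)) s
   ((2 * (f s - g s) * (F s - G s) + k * ((f s - g s)^2 + eta^2)) * exp (k * s))).
{ intros k s.
  assert (Df := Hf s). assert (Dg := Hg s).
  auto_derive.
  - repeat split; [exists (F s)|exists (G s)]; auto.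
  - rewrite (is_derive_unique (fun x : R => f x) _ _ Df), (is_derive_unique (fun x : R => g x) _ _ Dg). ring. }
destruct (Rle_dec 0 t) as [Ht|Ht].
- rewrite Rmin_left, Rmax_right in Hb by lra. rewrite Rabs_right by lra.
  assert (H := derive_nonneg_le _ _ 0 t Ht
     (fun s => is_derive_opp (V := R_NormedModule) _ _ _ (HV (- (3 * K)) s))).
  simpl in H. rewrite !Rmult_0_r, !exp_0 in H.
  assert (E : exp (3 * K * t) * exp (- (3 * K) * t) = 1).
  { rewrite <- exp_plus; replace (3 * K * t + - (3 * K) * t) with 0 by ring; apply exp_0. }
  assert (P := exp_pos (3 * K * t)). assert (P' := exp_pos (- (3 * K) * t)).
  assert (H' : opp (((f 0 - g 0) ^ 2 + eta ^ 2) * 1)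
      <= opp (((f t - g t) ^ 2 + eta ^ 2) * exp (- (3 * K) * t))).
  { apply H. intros s Hs. unfold opp; simpl.
    specialize (Hb s Hs). apply Rabs_le_between in Hb.
    assert (P2 := exp_pos (- (3 * K) * s)). simpl in *. nra. }
  unfold opp in H'; simpl in H'. simpl.
  set (a := (f t - g t) * ((f t - g t) * 1) + eta * (eta * 1)) in *.
  set (b := (f 0 - g 0) * ((f 0 - g 0) * 1) + eta * (eta * 1)) in *.
  replace a with (exp (3 * K * t) * (a * exp (- (3 * K) * t))).
  2: { transitivity (a * (exp (3 * K * t) * exp (- (3 * K) * t))); [ring|rewrite E; ring]. }
  apply Rmult_le_compat_l; lra.
- rewrite Rmin_right, Rmax_left in Hb by lra. rewrite Rabs_left by lra.
  assert (H := derive_nonneg_le _ _ t 0 ltac:(lra) (HV (3 * K))).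
  simpl in H. rewrite !Rmult_0_r, !exp_0 in H.
  assert (E : exp (3 * K * - t) * exp (3 * K * t) = 1).
  { rewrite <- exp_plus; replace (3 * K * -t + 3 * K * t) with 0 by ring; apply exp_0. }
  assert (P := exp_pos (3 * K * - t)).
  assert (H' : ((f t - g t) ^ 2 + eta ^ 2) * exp (3 * K * t)
      <= ((f 0 - g 0) ^ 2 + eta ^ 2) * 1).
  { apply H. intros s Hs.
    specialize (Hb s Hs). apply Rabs_le_between in Hb.
    assert (P2 := exp_pos (3 * K * s)). simpl in *. nra. }
  simpl in H'. simpl.
  set (a := (f t - g t) * ((f t - g t) * 1) + eta * (eta * 1)) in *.
  set (b := (f 0 - g 0) * ((f 0 - g 0) * 1) + eta * (eta * 1)) in *.
  replace a with (exp (3 * K * - t) * (a * exp (3 * K * t))).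
  2: { transitivity (a * (exp (3 * K * - t) * exp (3 * K * t))); [ring|rewrite E; ring]. }
  apply Rmult_le_compat_l; lra.
Qed.

Lemma ode_unique (f g F G : R -> R) (K t : R) :
  (forall s, is_derive f s (F s)) -> (forall s, is_derive g s (G s)) -> 1 <= K ->
  f 0 = g 0 ->
  (forall s, Rmin 0 t <= s <= Rmax 0 t -> Rabs (F s - G s) <= K * Rabs (f s - g s)) ->
  f t = g t.
Proof.
intros Hf Hg HK H0 HFG.
assert (H := gronwall f g F G K 0 t Hf Hg HK).
rewrite H0, Rminus_diag in H.
assert (A : (f t - g t)^2 + 0^2 <= exp (3 * K * Rabs t) * (0^2 + 0^2)).
{ apply H; intros s Hs; rewrite Rplus_0_r; auto. }
assert ((f t - g t)^2 = 0).
{ assert (B := pow2_ge_0 (f t - g t)). simpl in *. nra. }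
assert (f t - g t = 0) by nra. lra.
Qed.

(** The order of quantifiers is the point: [eta] depends on [K], [T] and [eps] only, not on the two
    equations compared. *)
Lemma gronwall_small (K T eps : R) :
  1 <= K -> 0 < eps -> exists eta, 0 < eta /\
  forall (f g F G : R -> R) (t : R),
  (forall s, is_derive f s (F s)) -> (forall s, is_derive g s (G s)) ->
  Rabs t <= T -> Rabs (f 0 - g 0) <= eta ->
  (forall s, Rabs s <= T -> Rabs (F s - G s) <= K * Rabs (f s - g s) + eta) ->
  Rabs (f t - g t) < eps.
Proof.
intros HK He.
set (q := exp (- (3 * K * T))). assert (Hq : 0 < q) by apply exp_pos.
assert (E : exp (3 * K * T) * q = 1).
{ unfold q; rewrite <- exp_plus, Rplus_opp_r; apply exp_0. }
(* With [eta = eps q' / 2] a product of two factors [q'] appears: one absorbs the exponential, the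
   other is merely at most 1. *)
set (q' := Rmin 1 q).
assert (Hq' : 0 < q' /\ q' <= 1 /\ q' <= q).
{ unfold q'; repeat split; [apply Rmin_pos; lra|apply Rmin_l|apply Rmin_r]. }
exists (eps * q' / 2); split; [apply Rdiv_lt_0_compat; [apply Rmult_lt_0_compat|]; lra|].
intros f g F G t Hf Hg Ht H0 HFG.
set (eta := eps * q' / 2) in *.
assert (Heta : 0 < eta) by (unfold eta; nra).
assert (H : (f t - g t)^2 + eta^2 <= exp (3 * K * Rabs t) * ((f 0 - g 0)^2 + eta^2)).
{ apply gronwall with F G; auto; intros s Hs; apply HFG.
  apply Rle_trans with (2 := Ht).
  destruct (Rle_dec 0 t).
  - rewrite Rmin_left, Rmax_right in Hs by lra; rewrite !Rabs_right; lra.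
  - rewrite Rmin_right, Rmax_left in Hs by lra; rewrite !Rabs_left1; lra. }
assert (H1 : exp (3 * K * Rabs t) <= exp (3 * K * T)).
{ destruct (Req_dec (Rabs t) T) as [->|Hn]; [lra|].
  left; apply exp_increasing. apply Rmult_lt_compat_l; lra. }
assert (H2 : (f 0 - g 0)^2 <= eta^2).
{ rewrite <- pow2_abs. apply pow_incr; split; [apply Rabs_pos|auto]. }
assert (H3 : (f t - g t)^2 + eta^2 <= exp (3 * K * T) * (2 * eta^2)).
{ apply Rle_trans with (1 := H).
  assert (0 <= (f 0 - g 0)^2) by apply pow2_ge_0.
  apply Rmult_le_compat; [left; apply exp_pos| |lra|lra].
  assert (0 <= eta^2) by apply pow2_ge_0; lra. }
assert (H4 : exp (3 * K * T) * (2 * eta^2) <= eps ^ 2).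
{ unfold eta. replace (exp (3 * K * T) * (2 * (eps * q' / 2) ^ 2))
    with (eps^2 / 2 * (exp (3 * K * T) * q' * q')) by field.
  assert (P := exp_pos (3 * K * T)).
  assert (exp (3 * K * T) * q' <= 1) by (rewrite <- E; apply Rmult_le_compat_l; lra).
  assert (exp (3 * K * T) * q' * q' <= 1 * 1).
  { apply Rmult_le_compat; try lra. apply Rmult_le_pos; lra. }
  assert (0 < eps^2) by (apply pow_lt; auto). nra. }
assert (0 < eta^2) by (apply pow_lt; auto).
rewrite <- (Rabs_right eps) by lra.
apply Rsqr_lt_abs_0. rewrite !Rsqr_pow2. lra.
Qed.

(** * Compactness in metric spaces *)

Lemma metric_nonneg {X} (d : X -> X -> R) x y : is_metric d -> 0 <= d x y.
Proof. intros H; apply H. Qed.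

Lemma metric_refl {X} (d : X -> X -> R) x : is_metric d -> d x x = 0.
Proof. intros H; apply H; reflexivity. Qed.

Lemma metric_sym {X} (d : X -> X -> R) x y : is_metric d -> d x y = d y x.
Proof. intros H; apply H. Qed.

Lemma metric_triangle {X} (d : X -> X -> R) x y z :
  is_metric d -> d x z <= d x y + d y z.
Proof. intros H; apply H. Qed.

(** Compactness of [[a, b]] as an induction principle: the supremum of the points reachable from [a]
    is itself reachable and can be passed unless it is [b]. *)
Lemma interval_induction (P : R -> R -> Prop) (a b : R) :
  a <= b ->
  (forall u v w, u <= v <= w -> P u v -> P v w -> P u w) ->
  (forall x, a <= x <= b -> exists del, 0 < del /\
     forall u v, x - del < u -> u <= x <= v -> v < x + del -> P u v) ->
  P a b.
Proof.
intros Hab Htr Hloc.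
destruct (completeness (fun s => a <= s <= b /\ P a s)) as [m [Hub Hlub]].
- exists b; intros s [Hs _]; lra.
- exists a; split; [lra|].
  destruct (Hloc a ltac:(lra)) as [del [Hd H]]; apply H; lra.
- assert (Ham : a <= m).
  { apply Hub; split; [lra|].
    destruct (Hloc a ltac:(lra)) as [del [Hd H]]; apply H; lra. }
  assert (Hmb : m <= b) by (apply Hlub; intros s [Hs _]; lra).
  destruct (Hloc m ltac:(lra)) as [del [Hd H]].
  assert (Hs : exists s, m - del < s <= m /\ a <= s /\ P a s).
  { apply NNPP; intros Hn.
    assert (m <= m - del); [|lra].
    apply Hlub; intros s [Hs HP].
    destruct (Rle_dec s (m - del)); auto.
    assert (s <= m) by (apply Hub; split; auto).
    exfalso; apply Hn; exists s; repeat split; auto; lra. }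
  destruct Hs as [s [Hs1 [Hs2 HP]]].
  set (v := Rmin b (m + del / 2)).
  assert (Hv : v <= b /\ v <= m + del / 2 /\ m <= v).
  { unfold v; repeat split; [apply Rmin_l|apply Rmin_r|apply Rmin_glb; lra]. }
  assert (Pv : P a v).
  { apply Htr with s; [lra|auto|]; apply H; lra. }
  destruct (Rle_dec b (m + del / 2)) as [Hb|Hb].
  + replace b with v; auto. unfold v; apply Rmin_left; auto.
  + assert (v = m + del / 2) by (unfold v; apply Rmin_right; lra).
    assert (v <= m); [apply Hub; split; [lra|auto]|lra].
Qed.

Lemma tube {X} (d : X -> X -> R) (P : R -> X -> Prop) (a b : R) (x : X) :
  a <= b ->
  (forall s, a <= s <= b -> exists del, 0 < del /\
     forall s' y, Rabs (s' - s) < del -> d x y < del -> P s' y) ->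
  exists del, 0 < del /\ forall s y, a <= s <= b -> d x y < del -> P s y.
Proof.
intros Hab Hloc.
apply (interval_induction (fun a b =>
  exists del, 0 < del /\ forall s y, a <= s <= b -> d x y < del -> P s y)); auto.
- intros u v w Huv [d1 [Hd1 H1]] [d2 [Hd2 H2]].
  exists (Rmin d1 d2); split; [apply Rmin_pos; auto|].
  intros s y Hs Hy; destruct (Rle_dec s v).
  + apply H1; [lra|]; apply Rlt_le_trans with (1 := Hy), Rmin_l.
  + apply H2; [lra|]; apply Rlt_le_trans with (1 := Hy), Rmin_r.
- intros s Hs; destruct (Hloc s Hs) as [del [Hd H]].
  exists del; split; auto; intros u v Hu Huv Hv.
  exists del; split; auto; intros s' y Hs'; apply H; apply Rabs_def1; lra.
Qed.

(** For an increasing cover the largest index of a finite subcover suffices; the uniform constants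
    below arise this way. *)
Lemma compact_increasing {X} (d : X -> X -> R) (K : X -> Prop) (U : nat -> X -> Prop) :
  is_compact d K -> (forall n, is_open d (U n)) ->
  (forall n m x, (n <= m)%nat -> U n x -> U m x) ->
  (forall x, K x -> exists n, U n x) -> exists n, forall x, K x -> U n x.
Proof.
intros HK HU Hinc Hcov.
destruct (HK nat U HU Hcov) as [l Hl].
exists (list_max l); intros x Kx; destruct (Hl x Kx) as [n [Hn Ux]].
apply Hinc with n; auto.
assert (H := proj1 (list_max_le l (list_max l)) (le_n _)).
rewrite Forall_forall in H; auto.
Qed.

Lemma compact_closed_subset {X} (d : X -> X -> R) (K C : X -> Prop) :
  is_compact d K -> (forall x, C x -> K x) -> is_open d (fun x => ~ C x) ->
  is_compact d C.
Proof.
intros HK HCK HC I U HU Hcov.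
destruct (HK (option I) (fun o x => match o with Some i => U i x | None => ~ C x end))
  as [l Hl].
- intros [i|]; auto.
- intros x Kx; destruct (classic (C x)) as [Cx|Cx].
  + destruct (Hcov x Cx) as [i Hi]; exists (Some i); auto.
  + exists None; auto.
- exists (flat_map (fun o => match o with Some i => i :: nil | None => nil end) l).
  intros x Cx; destruct (Hl x (HCK x Cx)) as [[i|] [Hi Ux]]; [|contradiction].
  exists i; split; auto; apply in_flat_map; exists (Some i); split; auto; left; auto.
Qed.

Lemma inv_succ_small (e : R) : 0 < e -> exists n, / INR (S n) < e.
Proof.
intros He; destruct (archimed_cor1 e He) as [n [Hn Hn0]].
exists n; apply Rle_lt_trans with (2 := Hn).
apply Rinv_le_contravar; [apply lt_0_INR; lia|apply le_INR; lia].
Qed.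

Lemma inv_succ_le (n m : nat) : (n <= m)%nat -> / INR (S m) <= / INR (S n).
Proof.
intros H; apply Rinv_le_contravar; [apply lt_0_INR; lia|apply le_INR; lia].
Qed.

Lemma inv_succ_pos (n : nat) : 0 < / INR (S n).
Proof. apply Rinv_0_lt_compat, lt_0_INR; lia. Qed.

Lemma compact_closed {X} (d : X -> X -> R) (K : X -> Prop) :
  is_metric d -> is_compact d K -> is_open d (fun x => ~ K x).
Proof.
intros Hd HK p Hp.
destruct (compact_increasing d K (fun n x => / INR (S n) < d p x) HK) as [n Hn].
- intros n x Hx; exists (d p x - / INR (S n)); split; [lra|]; intros y Hy.
  assert (A := metric_triangle d p y x Hd). rewrite (metric_sym d y x Hd) in A. lra.
- intros n m x Hnm Hx; apply Rle_lt_trans with (2 := Hx), inv_succ_le, Hnm.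
- intros x Kx; apply inv_succ_small.
  assert (A := metric_nonneg d p x Hd).
  destruct (Req_dec (d p x) 0) as [E|E]; [|lra].
  apply Hd in E; subst; contradiction.
- exists (/ INR (S n)); split; [apply inv_succ_pos|].
  intros y Hy Ky; specialize (Hn y Ky); lra.
Qed.

(** The constant is some [/ INR (S n)], hence at most 1; later this bounds the function [g] by 1. *)
Lemma compact_lower_bound {X} (d : X -> X -> R) (K : X -> Prop) (f : X -> R) :
  is_compact d K -> (forall r, is_open d (fun x => r < f x)) ->
  (forall x, K x -> 0 < f x) -> exists c, 0 < c <= 1 /\ forall x, K x -> c < f x.
Proof.
intros HK Hf Hpos.
destruct (compact_increasing d K (fun n x => / INR (S n) < f x) HK) as [n Hn].
- intros n; apply Hf.
- intros n m x Hnm Hx; apply Rle_lt_trans with (2 := Hx), inv_succ_le, Hnm.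
- intros x Kx; apply inv_succ_small, Hpos, Kx.
- exists (/ INR (S n)); split; [|exact Hn]; split; [apply inv_succ_pos|].
  rewrite <- Rinv_1; change 1 with (INR 1); apply (inv_succ_le 0 n); lia.
Qed.

Lemma compact_uniform_time {X} (d : X -> X -> R) (K : X -> Prop) (Q : R -> X -> Prop) :
  is_metric d -> is_compact d K -> is_open_RX d Q -> (forall x, K x -> Q 0 x) ->
  exists tau, 0 < tau /\ forall s x, K x -> Rabs s <= tau -> Q s x.
Proof.
intros Hd HK HQ H0.
(* The radius [e] makes these sets open: half of it remains around each nearby point. *)
destruct (compact_increasing d K (fun n x => exists e, 0 < e /\
  forall s y, d x y < e -> Rabs s <= / INR (S n) -> Q s y) HK) as [n Hn].
- intros n x [e [He H]]; exists (e / 2); split; [lra|]; intros y Hy.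
  exists (e / 2); split; [lra|]; intros s z Hz Hs; apply H; auto.
  assert (A := metric_triangle d x y z Hd); lra.
- intros n m x Hnm [e [He H]]; exists e; split; auto; intros s y Hy Hs.
  apply H; auto; apply Rle_trans with (1 := Hs), inv_succ_le, Hnm.
- intros x Kx; destruct (HQ 0 x (H0 x Kx)) as [e [He H]].
  destruct (inv_succ_small e He) as [n Hn].
  exists n; exists e; split; auto; intros s y Hy Hs; apply H; auto.
  rewrite Rminus_0_r; lra.
- exists (/ INR (S n)); split; [apply inv_succ_pos|]; intros s x Kx Hs.
  destruct (Hn x Kx) as [e [He H]]; apply H; auto.
  rewrite metric_refl; auto.
Qed.

Lemma list_upper_bound {I : Type} (f : I -> R) (l : list I) :
  exists M, forall i, In i l -> f i <= M.
Proof.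
induction l as [|i l [M HM]].
- exists 0; intros i [].
- exists (Rmax (f i) M); intros j [->|Hj]; [apply Rmax_l|].
  apply Rle_trans with M; [auto|apply Rmax_r].
Qed.

Lemma list_lower_bound_pos {I : Type} (f : I -> R) (l : list I) :
  (forall i, In i l -> 0 < f i) -> exists m, 0 < m /\ forall i, In i l -> m <= f i.
Proof.
induction l as [|i l IH]; intros Hf.
- exists 1; split; [lra|intros i []].
- destruct IH as [m [Hm H]]; [intros j Hj; apply Hf; right; auto|].
  exists (Rmin (f i) m); split.
  + apply Rmin_pos; auto; apply Hf; left; auto.
  + intros j [->|Hj]; [apply Rmin_l|]; apply Rle_trans with m; [apply Rmin_r|auto].
Qed.

(** Otherwise every point of [K] has a ball that [A] avoids from some time on; past the largest time
    of a finite subcover, [A] would have no point left in [K]. *)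
Lemma compact_cluster_point {X} (d : X -> X -> R) (K : X -> Prop) (A : R -> X -> Prop) :
  is_metric d -> is_compact d K ->
  (forall T, exists t x, T <= t /\ K x /\ A t x) ->
  exists p, K p /\ forall eps T, 0 < eps ->
    exists t x, T <= t /\ A t x /\ d p x < eps.
Proof.
intros Hd HK HA; apply NNPP; intros Hn.
set (U := fun (i : X * R * R) x => let '(p, e, T) := i in
   d p x < e /\ forall t x, T <= t -> A t x -> ~ d p x < e).
destruct (HK _ U) as [l Hl].
- intros [[p e] T] x [Hx H]; exists (e - d p x); split; [lra|]; intros y Hy.
  split; auto. assert (B := metric_triangle d p x y Hd); lra.
- intros p Kp; apply NNPP; intros Hp; apply Hn; exists p; split; auto.
  intros eps T He; apply NNPP; intros Hx; apply Hp; exists (p, eps, T); split.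
  + rewrite metric_refl; auto.
  + intros t x Ht Hxt Hlt; apply Hx; exists t, x; auto.
- destruct (list_upper_bound (fun i => snd i) l) as [M HM].
  destruct (HA M) as [t [x [Ht [Kx Ax]]]].
  destruct (Hl x Kx) as [[[p e] T] [Hi [Hx H]]].
  apply (H t x); auto. apply Rle_trans with (2 := Ht), (HM _ Hi).
Qed.

(** * Infima capped at 1 *)

Lemma cinf_exists {I : Type} (f : I -> R) (A : I -> Prop) :
  exists m, m <= 1 /\ ((forall i, A i -> 0 <= f i) ->
    0 <= m /\ (forall i, A i -> m <= f i) /\
    (forall c, c <= 1 -> (forall i, A i -> c <= f i) -> c <= m)).
Proof.
destruct (classic (forall i, A i -> 0 <= f i)) as [H|H].
2: { exists 0; split; [lra|]; intros H'; contradiction. }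
destruct (completeness (fun c => c <= 1 /\ forall i, A i -> c <= f i)) as [m [Hub Hlub]].
- exists 1; intros c [Hc _]; auto.
- exists 0; split; [lra|auto].
- exists m; split; [apply Hlub; intros c [Hc _]; auto|]; intros _.
  split; [apply Hub; split; [lra|auto]|]; split.
  + intros i Hi; apply Hlub; intros c [_ Hc]; auto.
  + intros c Hc1 Hc; apply Hub; split; auto.
Qed.

(* The infimum of [f] on [A], capped at 1 (hence 1 for empty [A]); unspecified if [f] takes
   negative values on [A]. *)
Definition cinf {I : Type} (f : I -> R) (A : I -> Prop) : R :=
  proj1_sig (constructive_indefinite_description _ (cinf_exists f A)).

Lemma cinf_le_1 {I : Type} (f : I -> R) (A : I -> Prop) : cinf f A <= 1.
Proof. unfold cinf; destruct constructive_indefinite_description as [m Hm]; apply Hm. Qed.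

Lemma cinf_nonneg {I : Type} (f : I -> R) (A : I -> Prop) :
  (forall i, A i -> 0 <= f i) -> 0 <= cinf f A.
Proof.
intros H; unfold cinf; destruct constructive_indefinite_description as [m [Hm1 Hm]]; simpl.
apply (proj1 (Hm H)).
Qed.

Lemma cinf_lb {I : Type} (f : I -> R) (A : I -> Prop) i :
  (forall i, A i -> 0 <= f i) -> A i -> cinf f A <= f i.
Proof.
intros H; unfold cinf; destruct constructive_indefinite_description as [m [Hm1 Hm]]; simpl.
intros Ai; apply (proj1 (proj2 (Hm H))), Ai.
Qed.

Lemma cinf_glb {I : Type} (f : I -> R) (A : I -> Prop) c :
  (forall i, A i -> 0 <= f i) -> c <= 1 -> (forall i, A i -> c <= f i) -> c <= cinf f A.
Proof.
intros H; unfold cinf; destruct constructive_indefinite_description as [m [Hm1 Hm]]; simpl.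
apply (proj2 (proj2 (Hm H))).
Qed.

Lemma cinf_le_cinf {I : Type} (f g : I -> R) (A : I -> Prop) eta :
  0 <= eta -> (forall i, A i -> 0 <= f i) -> (forall i, A i -> 0 <= g i) ->
  (forall i, A i -> g i < 1 -> f i <= g i + eta) ->
  cinf f A <= cinf g A + eta.
Proof.
intros He Hf Hg H; apply Rle_minus_l.
assert (H1 := cinf_le_1 f A).
apply cinf_glb; auto; [lra|]; intros i Hi.
destruct (Rlt_dec (g i) 1).
- specialize (H i Hi r). assert (A1 := cinf_lb f A i Hf Hi). lra.
- lra.
Qed.

(** Values of at least 1 are hidden by the cap, so closeness matters only where one function is
    below 1. For [speed] this localizes the infimum in time. *)
Lemma cinf_close {I : Type} (f g : I -> R) (A : I -> Prop) eta :
  0 <= eta -> (forall i, A i -> 0 <= f i) -> (forall i, A i -> 0 <= g i) ->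
  (forall i, A i -> f i < 1 \/ g i < 1 -> Rabs (f i - g i) <= eta) ->
  Rabs (cinf f A - cinf g A) <= eta.
Proof.
intros He Hf Hg H; apply Rabs_le.
assert (A1 : cinf f A <= cinf g A + eta).
{ apply cinf_le_cinf; auto; intros i Hi Hl.
  specialize (H i Hi (or_intror Hl)); apply Rabs_le_between in H; lra. }
assert (A2 : cinf g A <= cinf f A + eta).
{ apply cinf_le_cinf; auto; intros i Hi Hl.
  specialize (H i Hi (or_introl Hl)); apply Rabs_le_between in H; lra. }
lra.
Qed.

(** * Completing a partial flow by a time change *)

Section Completion.

Context {X : Type} (d : X -> X -> R) (Gamma : R -> X -> Prop) (phi : R -> X -> X).
Hypothesis Hd : is_metric d.
Hypothesis Hphi : is_partial_flow d Gamma phi.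

Lemma Gamma_open : is_open_RX d Gamma. Proof. apply Hphi. Qed.

Lemma phi_cont t x : Gamma t x -> forall eps, 0 < eps -> exists delta, 0 < delta /\
  forall s y, Gamma s y -> Rabs (s - t) < delta -> d x y < delta ->
  d (phi t x) (phi s y) < eps.
Proof. apply Hphi. Qed.

Lemma Gamma_convex x a b c : a <= c <= b -> Gamma a x -> Gamma b x -> Gamma c x.
Proof. apply Hphi. Qed.

Lemma Gamma_0 x : Gamma 0 x. Proof. apply Hphi. Qed.

Lemma Gamma_shift t x s : Gamma t x -> Gamma s (phi t x) <-> Gamma (s + t) x.
Proof. intros H; apply Hphi, H. Qed.

Lemma phi_0 x : phi 0 x = x. Proof. apply Hphi. Qed.

(* The axiom of a partial flow also asks for [Gamma s x]; small steps remove this condition. *)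
Lemma phi_phi s t x : Gamma t x -> Gamma (s + t) x -> phi s (phi t x) = phi (s + t) x.
Proof.
intros Ht Hst.
destruct (Gamma_open 0 x (Gamma_0 x)) as [e [He Hopen]].
destruct (inv_succ_small (e / (Rabs s + 1))) as [n Hn].
{ apply Rdiv_lt_0_compat; auto; assert (A := Rabs_pos s); lra. }
set (r := s * / INR (S n)).
assert (Hn0 : 0 < INR (S n)) by (apply lt_0_INR; lia).
assert (Hr : Rabs r < e).
{ unfold r; rewrite Rabs_mult, (Rabs_right (/ INR (S n))) by (left; apply inv_succ_pos).
  assert (A := Rabs_pos s). apply Rlt_div_r in Hn; [|lra].
  assert (B := inv_succ_pos n). nra. }
assert (Hrx : Gamma r x).
{ apply Hopen; [rewrite Rminus_0_r; auto|rewrite metric_refl; auto]. }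
assert (Hbetween : forall c, 0 <= c <= 1 -> Gamma (c * s + t) x).
{ intros c Hc; destruct (Rle_dec 0 s).
  - apply Gamma_convex with t (s + t); auto; nra.
  - apply Gamma_convex with (s + t) t; auto; nra. }
assert (Hk : forall k, (k <= S n)%nat -> Gamma (INR k * r + t) x).
{ intros k Hk. replace (INR k * r + t) with (INR k / INR (S n) * s + t)
    by (unfold r; field; lra).
  apply Hbetween; split.
  - apply Rdiv_le_0_compat; [apply pos_INR|lra].
  - apply Rle_div_l; [lra|]. rewrite Rmult_1_l; apply le_INR, Hk. }
assert (H : forall k, (k <= S n)%nat -> phi (INR k * r) (phi t x) = phi (INR k * r + t) x).
{ induction k as [|k IH]; intros Hle.
  - simpl; rewrite Rmult_0_l, Rplus_0_l; apply phi_0.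
  - assert (E : INR (S k) * r = r + INR k * r) by (rewrite S_INR; ring).
    assert (Hr1 := Hk 1%nat ltac:(lia)). simpl in Hr1; rewrite Rmult_1_l in Hr1.
    assert (HSk := Hk (S k) Hle).
    rewrite E in HSk; rewrite E.
    (* The axiom is used twice: at [phi t x], where all times involved lie in the domain, and at
       [x], where [Gamma r x] holds because [r] is small. *)
    destruct Hphi as (_ & _ & _ & _ & _ & _ & Hc).
    rewrite <- Hc.
    + rewrite IH by lia.
      rewrite Hc; [f_equal; ring|auto|apply Hk; lia|]. rewrite <- Rplus_assoc; auto.
    + apply Gamma_shift; auto.
    + apply Gamma_shift; auto; apply Hk; lia.
    + apply Gamma_shift; auto. }
specialize (H (S n) (le_n _)).
replace (INR (S n) * r) with s in H by (unfold r; field; lra).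
exact H.
Qed.

Lemma phi_close x a b eps : a <= b -> Gamma a x -> Gamma b x -> 0 < eps ->
  exists delta, 0 < delta /\ forall s y, a <= s <= b -> d x y < delta ->
    Gamma s y /\ d (phi s x) (phi s y) < eps.
Proof.
intros Hab Ha Hb He.
apply (tube d (fun s y => Gamma s y /\ d (phi s x) (phi s y) < eps)); auto.
intros s Hs; assert (Hsx := Gamma_convex x a b s Hs Ha Hb).
destruct (phi_cont s x Hsx (eps / 2) ltac:(lra)) as [d1 [Hd1 H1]].
destruct (Gamma_open s x Hsx) as [d2 [Hd2 H2]].
exists (Rmin d1 d2); split; [apply Rmin_pos; auto|]; intros s' y Hs' Hy.
assert (L := Rmin_l d1 d2). assert (L' := Rmin_r d1 d2).
assert (Gy : Gamma s' y) by (apply H2; lra).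
assert (Gx : Gamma s' x) by (apply H2; [lra|rewrite metric_refl; auto]).
split; auto.
assert (A1 := H1 s' y Gy ltac:(lra) ltac:(lra)).
assert (A2 := H1 s' x Gx ltac:(lra) ltac:(rewrite metric_refl; auto)).
assert (A3 := metric_triangle d (phi s' x) (phi s x) (phi s' y) Hd).
rewrite (metric_sym d (phi s' x) (phi s x)) in A3 by auto. lra.
Qed.

(** * The regularized speed along orbits *)

Context (N : X -> Prop) (w : X -> R) (C K : R).
Hypothesis w_nonneg : forall x, 0 <= w x.
Hypothesis w_supp : forall x, 0 < w x -> N x.
Hypothesis C_pos : 0 < C.
Hypothesis w_lip : forall x y, Rabs (w x - w y) <= C * d x y.
Hypothesis K_ge_1 : 1 <= K.
Hypothesis N_time : forall s x, N x -> Rabs s <= / K -> Gamma s x.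

(** The value 0 off the domain forces the speed to vanish there, so the clock cannot run past the
    end of an orbit. *)
Definition orbit_weight (x : X) (s : R) : R :=
  if excluded_middle_informative (Gamma s x) then w (phi s x) else 0.

(* Inf-convolution in the time variable makes the speed [K]-Lipschitz along orbits. *)
Definition speed (x : X) (s : R) : R :=
  cinf (fun s' => orbit_weight x s' + K * Rabs (s' - s)) (fun _ => True).

Lemma orbit_weight_nonneg x s : 0 <= orbit_weight x s.
Proof. unfold orbit_weight; destruct excluded_middle_informative; auto; lra. Qed.

Lemma speed_arg_nonneg x s s' : 0 <= orbit_weight x s' + K * Rabs (s' - s).
Proof.
assert (A := orbit_weight_nonneg x s'). assert (B := Rabs_pos (s' - s)).
assert (0 <= K * Rabs (s' - s)) by (apply Rmult_le_pos; lra). lra.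
Qed.

Lemma speed_nonneg x s : 0 <= speed x s.
Proof. apply cinf_nonneg; intros s' _; apply speed_arg_nonneg. Qed.

Lemma speed_le_1 x s : speed x s <= 1.
Proof. apply cinf_le_1. Qed.

Lemma speed_lip x s t : Rabs (speed x s - speed x t) <= K * Rabs (s - t).
Proof.
apply cinf_close; try (intros s' _; apply speed_arg_nonneg).
- apply Rmult_le_pos; [lra|apply Rabs_pos].
- intros s' _ _.
  replace (orbit_weight x s' + K * Rabs (s' - s) - (orbit_weight x s' + K * Rabs (s' - t)))
    with (K * (Rabs (s' - s) - Rabs (s' - t))) by ring.
  rewrite Rabs_mult, (Rabs_right K) by lra.
  apply Rmult_le_compat_l; [lra|].
  eapply Rle_trans; [apply Rabs_triang_inv2|].
  replace (s' - s - (s' - t)) with (- (s - t)) by ring. rewrite Rabs_Ropp; lra.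
Qed.

Lemma speed_le_weight x s : speed x s <= orbit_weight x s.
Proof.
eapply Rle_trans; [apply (cinf_lb _ _ s)|]; auto.
- intros s' _; apply speed_arg_nonneg.
- simpl; rewrite Rminus_diag, Rabs_R0; lra.
Qed.

Lemma speed_pos x s : 0 < speed x s -> Gamma s x /\ N (phi s x).
Proof.
intros H; assert (A := speed_le_weight x s); unfold orbit_weight in A.
destruct excluded_middle_informative; [|lra].
split; auto; apply w_supp; lra.
Qed.

Lemma orbit_weight_shift x a s : Gamma a x -> orbit_weight (phi a x) s = orbit_weight x (s + a).
Proof.
intros Ha; unfold orbit_weight.
destruct excluded_middle_informative as [H|H]; destruct excluded_middle_informative as [H'|H'].
- rewrite phi_phi; auto.
- apply Gamma_shift in H; auto; contradiction.
- apply Gamma_shift in H'; auto; contradiction.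
- reflexivity.
Qed.

(** The speed thus depends on the point [phi s x] alone and not on the starting point, which makes
    the slowed motion a flow. *)
Lemma speed_shift x a s : Gamma a x -> speed (phi a x) s = speed x (s + a).
Proof.
intros Ha; apply Rle_antisym.
- apply cinf_glb; [intros; apply speed_arg_nonneg|apply speed_le_1|]; intros s' _.
  eapply Rle_trans; [apply (cinf_lb _ _ (s' - a)); auto; intros; apply speed_arg_nonneg|].
  rewrite orbit_weight_shift by auto.
  replace (s' - a + a) with s' by ring. replace (s' - a - s) with (s' - (s + a)) by ring. lra.
- apply cinf_glb; [intros; apply speed_arg_nonneg|apply speed_le_1|]; intros s' _.
  eapply Rle_trans; [apply (cinf_lb _ _ (s' + a)); auto; intros; apply speed_arg_nonneg|].
  rewrite orbit_weight_shift by auto.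
  replace (s' + a - (s + a)) with (s' - s) by ring. lra.
Qed.

(** Within time [/ K] the weight alone is at least 1; beyond it the penalty [K * Rabs r] is. *)
Lemma speed_1 x s : Gamma s x ->
  (forall r, Rabs r <= / K -> Gamma r (phi s x) /\ 1 <= w (phi r (phi s x))) ->
  speed x s = 1.
Proof.
intros Hs H; rewrite <- (Rplus_0_l s), <- speed_shift by auto.
apply Rle_antisym; [apply speed_le_1|].
apply cinf_glb; [intros; apply speed_arg_nonneg|lra|]; intros r _.
rewrite Rminus_0_r.
destruct (Rle_dec (Rabs r) (/ K)) as [Hr|Hr].
- destruct (H r Hr) as [Gr wr]; unfold orbit_weight.
  destruct excluded_middle_informative; [|contradiction].
  assert (B := Rabs_pos r). assert (0 <= K * Rabs r) by (apply Rmult_le_pos; lra). lra.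
- assert (A := orbit_weight_nonneg (phi s x) r).
  assert (K * / K <= K * Rabs r) by (apply Rmult_le_compat_l; lra).
  rewrite Rinv_r in H0 by lra. lra.
Qed.

(** Only times less than [/ K] away from [s] contribute values below the cap, hence the margin [/ K]
    at both ends. *)
Lemma speed_close x a b eta : a <= b -> Gamma (a - / K) x -> Gamma (b + / K) x ->
  0 < eta -> exists delta, 0 < delta /\ forall s y, a <= s <= b -> d x y < delta ->
  Rabs (speed x s - speed y s) <= eta.
Proof.
intros Hab Ha Hb He.
assert (HK : 0 < / K) by (apply Rinv_0_lt_compat; lra).
destruct (phi_close x (a - / K) (b + / K) (eta / C)) as [del [Hdel H]]; auto.
{ lra. } { apply Rdiv_lt_0_compat; auto. }
exists del; split; auto; intros s y Hs Hy.
apply cinf_close; try (intros; apply speed_arg_nonneg); [lra|]; intros r _ Hr.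
assert (Hrs : Rabs (r - s) < / K).
{ assert (A := orbit_weight_nonneg x r). assert (A' := orbit_weight_nonneg y r).
  apply Rmult_lt_reg_l with K; [lra|]. rewrite Rinv_r by lra. lra. }
apply Rabs_def2 in Hrs.
assert (Gx : Gamma r x).
{ apply Gamma_convex with (a - / K) (b + / K); auto; lra. }
destruct (H r y ltac:(lra) Hy) as [Gy Hxy].
unfold orbit_weight; do 2 (destruct excluded_middle_informative; [|contradiction]).
replace (w (phi r x) + K * Rabs (r - s) - (w (phi r y) + K * Rabs (r - s)))
  with (w (phi r x) - w (phi r y)) by ring.
eapply Rle_trans; [apply w_lip|].
apply Rle_trans with (C * (eta / C)); [apply Rmult_le_compat_l; lra|].
right; field; lra.
Qed.

(** * The clock and the slowed flow *)

Lemma clock_exists x :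
  exists f, f 0 = 0 /\ forall t, is_derive f t (speed x (f t)).
Proof.
apply (picard_lindelof (fun _ u => speed x u) K 1 0); [lra| | |].
- intros _ u v; apply speed_lip.
- intros u t eps He; exists 1; split; [lra|]; intros s _.
  rewrite Rminus_diag, Rabs_R0; auto.
- intros _; apply Rabs_le; assert (A := speed_nonneg x 0).
  assert (B := speed_le_1 x 0); lra.
Qed.

Definition clock (x : X) : R -> R :=
  proj1_sig (constructive_indefinite_description _ (clock_exists x)).

Lemma clock_0 x : clock x 0 = 0.
Proof. unfold clock; destruct constructive_indefinite_description as [f Hf]; apply Hf. Qed.

Lemma clock_derive x t : is_derive (clock x) t (speed x (clock x t)).
Proof. unfold clock; destruct constructive_indefinite_description as [f Hf]; apply Hf. Qed.

Lemma clock_incr x s t : s <= t -> clock x s <= clock x t.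
Proof.
intros Hst; apply (derive_nonneg_le _ (fun s => speed x (clock x s))); auto.
- apply clock_derive.
- intros; apply speed_nonneg.
Qed.

Lemma clock_le x s t : s <= t -> clock x t - clock x s <= t - s.
Proof.
intros Hst.
assert (H : s - clock x s <= t - clock x t); [|lra].
apply (derive_nonneg_le (fun s => s - clock x s) (fun s => 1 - speed x (clock x s))); auto.
- intros r; apply (is_derive_minus (V := R_NormedModule));
    [apply (is_derive_id (K := R_AbsRing))|apply clock_derive].
- intros r _; assert (A := speed_le_1 x (clock x r)); lra.
Qed.

Lemma clock_lip x s t : Rabs (clock x s - clock x t) <= Rabs (s - t).
Proof.
destruct (Rle_dec s t).
- rewrite (Rabs_minus_sym s), (Rabs_minus_sym (clock x s)).
  assert (A := clock_incr x s t ltac:(auto)). assert (B := clock_le x s t ltac:(auto)).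
  rewrite !Rabs_right; lra.
- assert (A := clock_incr x t s ltac:(lra)). assert (B := clock_le x t s ltac:(lra)).
  rewrite !Rabs_right; lra.
Qed.

(** A zero of the speed is a constant solution, so by uniqueness a clock found there has been there
    since time 0. *)
Lemma clock_stop x t : speed x (clock x t) = 0 -> clock x t = 0.
Proof.
intros H.
assert (E : (fun s => clock x (s + t)) (- t) = (fun _ => clock x t) (- t)).
{ apply (ode_unique (fun s => clock x (s + t)) (fun _ => clock x t)
    (fun s => speed x (clock x (s + t))) (fun _ => 0) K); auto.
  - intros s.
    assert (D := is_derive_comp (clock x) (fun s => s + t) s _ 1 (clock_derive x (s + t))).
    evar_last; [apply D|unfold scal; simpl; unfold mult; simpl; ring].
    auto_derive; auto.
  - intros; apply is_derive_cst.
  - simpl; rewrite Rplus_0_l; reflexivity.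
  - intros s _; rewrite <- H at 1; apply speed_lip. }
simpl in E; rewrite Rplus_opp_l, clock_0 in E; auto.
Qed.

(** Completeness of the slowed flow: either the speed is positive, which happens only inside the
    domain, or the clock has never moved. *)
Lemma clock_dom x t : Gamma (clock x t) x.
Proof.
destruct (Req_dec (speed x (clock x t)) 0) as [E|E].
- rewrite clock_stop by auto; apply Gamma_0.
- apply speed_pos; assert (A := speed_nonneg x (clock x t)); lra.
Qed.

Lemma clock_shift x s t : clock (phi (clock x t) x) s + clock x t = clock x (s + t).
Proof.
set (y := phi (clock x t) x).
apply (ode_unique (fun s => clock y s + clock x t) (fun s => clock x (s + t))
  (fun s => speed x (clock y s + clock x t)) (fun s => speed x (clock x (s + t))) K); auto.
- intros r; rewrite <- speed_shift by apply clock_dom; fold y.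
  evar_last; [apply (is_derive_plus (V := R_NormedModule)); [apply clock_derive|apply is_derive_cst]|].
  apply Rplus_0_r.
- intros r.
  assert (D := is_derive_comp (clock x) (fun s => s + t) r _ 1 (clock_derive x (r + t))).
  evar_last; [apply D|unfold scal; simpl; unfold mult; simpl; ring].
  auto_derive; auto.
- simpl; rewrite clock_0, !Rplus_0_l; auto.
- intros r _; apply speed_lip.
Qed.

Definition slow_flow (t : R) (x : X) : X := phi (clock x t) x.

Lemma slow_flow_0 x : slow_flow 0 x = x.
Proof. unfold slow_flow; rewrite clock_0; apply phi_0. Qed.

Lemma slow_flow_add s t x : slow_flow s (slow_flow t x) = slow_flow (s + t) x.
Proof.
unfold slow_flow.
rewrite phi_phi; [|apply clock_dom|]; rewrite clock_shift; auto; apply clock_dom.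
Qed.

(** The same dichotomy: a point that moves is in the support of [w], which lies in [N]. *)
Lemma slow_flow_stays t x : N x -> N (slow_flow t x).
Proof.
intros Nx; unfold slow_flow.
destruct (Req_dec (speed x (clock x t)) 0) as [E|E].
- rewrite clock_stop, phi_0; auto.
- apply speed_pos; assert (A := speed_nonneg x (clock x t)); lra.
Qed.

Lemma clock_close x T eps : N x -> 0 < eps -> exists delta, 0 < delta /\
  forall t y, Rabs t <= T -> d x y < delta -> Rabs (clock x t - clock y t) < eps.
Proof.
intros Nx He.
destruct (Rle_dec 0 T) as [HT|HT].
2: { exists 1; split; [lra|]; intros t y Ht; assert (A := Rabs_pos t); lra. }
assert (HK : 0 < / K) by (apply Rinv_0_lt_compat; lra).
destruct (gronwall_small K T eps K_ge_1 He) as [eta [Heta Hg]].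
(* The slowed orbit stays in [N], so [N_time] supplies the margin that [speed_close] asks for. *)
assert (Hedge : forall t r, Rabs r <= / K -> Gamma (r + clock x t) x).
{ intros t r Hr; apply Gamma_shift; [apply clock_dom|].
  apply N_time; auto; apply (slow_flow_stays t), Nx. }
destruct (speed_close x (clock x (- T)) (clock x T) eta) as [del [Hdel H]]; auto.
- apply clock_incr; lra.
- replace (clock x (- T) - / K) with (- / K + clock x (- T)) by ring.
  apply Hedge; rewrite Rabs_Ropp, Rabs_right; lra.
- rewrite Rplus_comm; apply Hedge; rewrite Rabs_right; lra.
- exists del; split; auto; intros t y Ht Hy.
  apply (Hg _ _ (fun s => speed x (clock x s)) (fun s => speed y (clock y s))); auto.
  + apply clock_derive.
  + apply clock_derive.
  + rewrite !clock_0, Rminus_diag, Rabs_R0; lra.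
  + intros s Hs; apply Rabs_le_between in Hs.
    replace (speed x (clock x s) - speed y (clock y s)) with
      ((speed x (clock x s) - speed y (clock x s)) +
       (speed y (clock x s) - speed y (clock y s))) by ring.
    eapply Rle_trans; [apply Rabs_triang|].
    assert (A := speed_lip y (clock x s) (clock y s)).
    assert (B := H (clock x s) y).
    assert (B' : Rabs (speed x (clock x s) - speed y (clock x s)) <= eta).
    { apply B; auto; split; apply clock_incr; lra. }
    lra.
Qed.

Lemma slow_flow_cont t x eps : N x -> 0 < eps -> exists delta, 0 < delta /\
  forall s y, Rabs (s - t) < delta -> d x y < delta ->
    d (slow_flow t x) (slow_flow s y) < eps.
Proof.
intros Nx He.
destruct (phi_cont (clock x t) x (clock_dom x t) eps He) as [d1 [Hd1 H1]].
destruct (clock_close x (Rabs t + 1) (d1 / 2) Nx ltac:(lra)) as [d2 [Hd2 H2]].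
exists (Rmin (Rmin 1 (d1 / 2)) (Rmin d1 d2)).
assert (L1 := Rmin_l (Rmin 1 (d1 / 2)) (Rmin d1 d2)).
assert (L2 := Rmin_r (Rmin 1 (d1 / 2)) (Rmin d1 d2)).
assert (L3 := Rmin_l 1 (d1 / 2)). assert (L4 := Rmin_r 1 (d1 / 2)).
assert (L5 := Rmin_l d1 d2). assert (L6 := Rmin_r d1 d2).
split; [repeat apply Rmin_pos; lra|]; intros s y Hs Hy.
apply H1; [apply clock_dom| |lra].
replace (clock y s - clock x t) with ((clock y s - clock x s) + (clock x s - clock x t)) by ring.
eapply Rle_lt_trans; [apply Rabs_triang|].
assert (A1 : Rabs (clock x s - clock y s) < d1 / 2).
{ apply H2; [|lra]. replace s with (t + (s - t)) by ring.
  eapply Rle_trans; [apply Rabs_triang|lra]. }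
rewrite Rabs_minus_sym in A1.
assert (A2 := clock_lip x s t). lra.
Qed.

Lemma slow_flow_eq t x :
  (forall s, Rmin 0 t <= s <= Rmax 0 t -> speed x s = 1) -> slow_flow t x = phi t x.
Proof.
intros H; unfold slow_flow; f_equal.
apply (ode_unique (clock x) (fun s => s) (fun s => speed x (clock x s)) (fun _ => 1) K); auto.
- apply clock_derive.
- intros s; apply (is_derive_id (K := R_AbsRing)).
- apply clock_0.
- intros s Hs; rewrite <- (H s Hs); apply speed_lip.
Qed.

(** Unlike in [slow_flow_eq], the speed is known along the slowed orbit only; the equality then
    shows through [clock_dom] that every time [t] is in the domain. *)
Lemma clock_eq t x :
  (forall s, speed x (clock x s) = 1) -> clock x t = t.
Proof.
intros H.
apply (ode_unique (clock x) (fun s => s) (fun s => speed x (clock x s)) (fun _ => 1) K); auto.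
- apply clock_derive.
- intros s; apply (is_derive_id (K := R_AbsRing)).
- apply clock_0.
- intros s Hs; rewrite H, Rminus_diag, Rabs_R0.
  apply Rmult_le_pos; [lra|apply Rabs_pos].
Qed.

End Completion.

(** The last two clauses compare the flows in opposite directions: from a piece of a [phi]-orbit,
    for the conjugacy, and from a complete [theta]-orbit, for the isolation of [L]. *)
Lemma time_changed_flow {X : Type} (d : X -> X -> R) (Gamma : R -> X -> Prop)
  (phi : R -> X -> X) (N : X -> Prop) (w : X -> R) (C K : R) :
  is_metric d -> is_partial_flow d Gamma phi ->
  (forall x, 0 <= w x) -> (forall x, 0 < w x -> N x) ->
  0 < C -> (forall x y, Rabs (w x - w y) <= C * d x y) ->
  1 <= K -> (forall s x, N x -> Rabs s <= / K -> Gamma s x) ->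
  let P := fun y => forall r, Rabs r <= / K -> Gamma r y /\ 1 <= w (phi r y) in
  exists theta : R -> X -> X,
    (forall x, theta 0 x = x) /\
    (forall s t x, theta s (theta t x) = theta (s + t) x) /\
    (forall t x, N x -> N (theta t x)) /\
    (forall t x eps, N x -> 0 < eps -> exists delta, 0 < delta /\
       forall s y, Rabs (s - t) < delta -> d x y < delta ->
         d (theta t x) (theta s y) < eps) /\
    (forall t x, exists s, Gamma s x /\ theta t x = phi s x) /\
    (forall t x, (forall s, Rmin 0 t <= s <= Rmax 0 t -> Gamma s x /\ P (phi s x)) ->
       theta t x = phi t x) /\
    (forall x, (forall t, P (theta t x)) -> forall t, Gamma t x /\ theta t x = phi t x).
Proof.
intros Hd Hphi Hw Hwsupp HC Hwlip HK HN P.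
exists (slow_flow Gamma phi w K Hw HK).
split; [|split; [|split; [|split; [|split; [|split]]]]].
- intros x; apply (slow_flow_0 d); auto.
- intros s t x; apply (slow_flow_add d) with N; auto.
- intros t x; apply (slow_flow_stays d); auto.
- intros t x eps; apply slow_flow_cont with C; auto.
- intros t x; exists (clock Gamma phi w K Hw HK x t); split; auto.
  apply (clock_dom d) with N; auto.
- intros t x H; apply slow_flow_eq; intros s Hs; destruct (H s Hs) as [G HP].
  apply (speed_1 d); auto.
- intros x H t.
  assert (E : clock Gamma phi w K Hw HK x t = t).
  { apply clock_eq; intros s; apply (speed_1 d); auto.
    - apply (clock_dom d) with N; auto.
    - apply H. }
  split; [|unfold slow_flow; rewrite E; auto].
  rewrite <- E; apply (clock_dom d) with N; auto.
Qed.

(** * Flows with a Lyapunov function *)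

Lemma flow_cont {Y} (dY : Y -> Y -> R) psi : is_flow dY psi ->
  forall t x eps, 0 < eps -> exists delta, 0 < delta /\
  forall s y, Rabs (s - t) < delta -> dY x y < delta -> dY (psi t x) (psi s y) < eps.
Proof.
intros H t x eps He; destruct H as (_ & H & _).
destruct (H t x I eps He) as [del [Hd H']]; exists del; split; auto.
Qed.

Lemma flow_0 {Y} (dY : Y -> Y -> R) psi : is_flow dY psi -> forall x, psi 0 x = x.
Proof. intros H; apply H. Qed.

Lemma flow_add {Y} (dY : Y -> Y -> R) psi : is_flow dY psi ->
  forall s t x, psi s (psi t x) = psi (s + t) x.
Proof. intros H s t x; apply H; auto. Qed.

Lemma flow_intro {Y} (dY : Y -> Y -> R) psi :
  (forall t x eps, 0 < eps -> exists delta, 0 < delta /\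
   forall s y, Rabs (s - t) < delta -> dY x y < delta -> dY (psi t x) (psi s y) < eps) ->
  (forall x, psi 0 x = x) -> (forall s t x, psi s (psi t x) = psi (s + t) x) ->
  is_flow dY psi.
Proof.
intros Hc H0 Ha; repeat split; auto.
- intros t x _; exists 1; split; [lra|auto].
- intros t x _ eps He; destruct (Hc t x eps He) as [del [Hd H]]; exists del; split; auto.
Qed.

Lemma flow_reverse {Y} (dY : Y -> Y -> R) psi :
  is_flow dY psi -> is_flow dY (fun t x => psi (- t) x).
Proof.
intros H; apply flow_intro.
- intros t x eps He; destruct (flow_cont dY psi H (- t) x eps He) as [del [Hd H']].
  exists del; split; auto; intros s y Hs; apply H'.
  replace (- s - - t) with (- (s - t)) by ring; rewrite Rabs_Ropp; auto.
- intros x; rewrite Ropp_0; apply (flow_0 dY); auto.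
- intros s t x; rewrite (flow_add dY) by auto; f_equal; ring.
Qed.

Lemma tends_to_set_reverse {Y} (dY : Y -> Y -> R) (psi : R -> Y) A :
  tends_to_set_pinf dY (fun t => psi (- t)) A <-> tends_to_set_minf dY psi A.
Proof.
split; intros H eps He; destruct (H eps He) as [T HT]; exists (- T); intros t Ht.
- rewrite <- (Ropp_involutive t); apply HT; lra.
- apply HT; lra.
Qed.

Lemma tends_to_reverse {Y} (dY : Y -> Y -> R) (psi : R -> Y) p :
  tends_to_pinf dY (fun t => psi (- t)) p <-> tends_to_minf dY psi p.
Proof.
split; intros H eps He; destruct (H eps He) as [T HT]; exists (- T); intros t Ht.
- rewrite <- (Ropp_involutive t); apply HT; lra.
- apply HT; lra.
Qed.

(* LaSalle's principle: a Lyapunov function is constant on the orbit of a limit point. *)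
Lemma lyapunov_limit {Y} (dY : Y -> Y -> R) (psi : R -> Y -> Y) (lev : Y -> R)
    (L : Y -> Prop) (omega : Y) :
  is_metric dY -> is_compact dY (fun _ => True) -> is_flow dY psi ->
  (forall y z, Rabs (lev y - lev z) <= dY y z) ->
  (forall y s t, s <= t -> lev (psi s y) <= lev (psi t y)) ->
  (forall y, dY y omega = 1 - lev y) ->
  (forall y, -1 < lev y < 1 -> (forall t, lev (psi t y) = lev y) -> L y) ->
  forall y, -1 < lev y ->
  tends_to_set_pinf dY (fun t => psi t y) L \/ tends_to_pinf dY (fun t => psi t y) omega.
Proof.
intros Hd HY Hpsi Hlip Hmon Homega Hconst y Hy.
(* If the levels approach 1, monotonicity and the formula for the distance to [omega] give
   convergence; otherwise they stay below some [1 - e0]. *)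
destruct (classic (forall eps, 0 < eps -> exists T, 1 - eps < lev (psi T y))) as [H1|H1].
{ right; intros eps He; destruct (H1 eps He) as [T HT]; exists T; intros t Ht.
  rewrite Homega; assert (A := Hmon y T t Ht); lra. }
left; apply not_all_ex_not in H1; destruct H1 as [e0 H1].
apply imply_to_and in H1; destruct H1 as [He0 H1].
assert (Hup : forall t, lev (psi t y) <= 1 - e0).
{ intros t; apply Rnot_lt_le; intros Ht; apply H1; exists t; auto. }
intros eps He; apply NNPP; intros Hn.
destruct (compact_cluster_point dY (fun _ => True)
  (fun t x => x = psi t y /\ ~ exists z, L z /\ dY x z < eps)) as [p [_ Hp]]; auto.
{ intros T; apply NNPP; intros HT; apply Hn; exists T; intros t Ht.
  apply NNPP; intros Hz; apply HT; exists t, (psi t y); repeat split; auto. }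
(* Each level on the orbit of [p] is approximated by levels of [psi t y] at arbitrarily late
   times. *)
assert (Hlim : forall s e T, 0 < e ->
  exists t, T <= t /\ Rabs (lev (psi s p) - lev (psi t y)) < e).
{ intros s e T Hep; destruct (flow_cont dY psi Hpsi s p e Hep) as [del [Hdel Hc]].
  destruct (Hp del (T - s) Hdel) as [t [x [Ht [[-> _] Hx]]]].
  exists (s + t); split; [lra|].
  eapply Rle_lt_trans; [apply Hlip|]. rewrite <- (flow_add dY) by auto.
  apply Hc; auto; rewrite Rminus_diag, Rabs_R0; auto. }
(* No order between [s] and [s'] is assumed: both sides are the limit of the same monotone function
   of time. *)
assert (Hle : forall s s', lev (psi s p) <= lev (psi s' p)).
{ intros s s'; apply Rnot_lt_le; intros Hlt.
  set (e := (lev (psi s p) - lev (psi s' p)) / 2) in *.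
  destruct (Hlim s e 0 ltac:(unfold e; lra)) as [t1 [_ A1]].
  destruct (Hlim s' e t1 ltac:(unfold e; lra)) as [t2 [Ht A2]].
  assert (A3 := Hmon y t1 t2 Ht).
  apply Rabs_def2 in A1; apply Rabs_def2 in A2; unfold e in *; lra. }
assert (Lp : L p).
{ apply Hconst.
  - rewrite <- (flow_0 dY psi Hpsi p). split; apply Rnot_le_lt; intros Hcontra.
    + destruct (Hlim 0 ((lev y + 1) / 2) 0 ltac:(lra)) as [t [Ht A]].
      apply Rabs_def2 in A; assert (B := Hmon y 0 t Ht).
      rewrite (flow_0 dY psi Hpsi y) in B; lra.
    + destruct (Hlim 0 (e0 / 2) 0 ltac:(lra)) as [t [Ht A]].
      apply Rabs_def2 in A; assert (B := Hup t); lra.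
  - intros t; rewrite <- (flow_0 dY psi Hpsi p) at 2; apply Rle_antisym; apply Hle. }
destruct (Hp eps 0 He) as [t [x [_ [[_ Hx] Hpx]]]].
apply Hx; exists p; split; auto; rewrite metric_sym; auto.
Qed.

(** Points outside the attractor tend backwards to [alpha], at level -1, so they leave
    [lev >= -1/2], while the attractor lies in [lev >= 0]. Keeping [W] abstract lets the
    time-reversed flow use [Ws] of the original one. *)
Lemma level_attractor {Y} (dY : Y -> Y -> R) (psi : R -> Y -> Y) (lev : Y -> R)
    (L W : Y -> Prop) (alpha omega : Y) :
  is_compact dY (fun _ => True) -> is_flow dY psi ->
  (forall y z, Rabs (lev y - lev z) <= dY y z) ->
  (forall y s t, s <= t -> lev (psi s y) <= lev (psi t y)) ->
  lev alpha = -1 -> lev omega = 1 ->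
  (forall t, psi t omega = omega) ->
  (forall y, L y -> lev y = 0) ->
  (forall y t, L y -> L (psi t y)) ->
  (forall y, y <> omega -> W y \/ tends_to_minf dY (fun t => psi t y) alpha) ->
  (forall y, W y <-> Wu dY psi L y) ->
  is_attractor dY (fun _ _ => True) psi (fun y => y = omega \/ L y \/ W y).
Proof.
intros HY Hpsi Hlip Hmon Ha Ho Hof HL0 HLinv Hback HW.
assert (Hopen : forall P : R -> Prop, (forall r, P r -> exists e, 0 < e /\ forall r', Rabs (r - r') < e -> P r') ->
  is_open dY (fun y => P (lev y))).
{ intros P HP y Hy; destruct (HP _ Hy) as [e [He H]]; exists e; split; auto.
  intros z Hz; apply H; eapply Rle_lt_trans; [apply Hlip|auto]. }
assert (HWlev : forall y, W y -> 0 <= lev y).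
{ intros y Wy; apply HW in Wy; apply Rnot_lt_le; intros Hlt.
  destruct (Wy (- lev y / 2) ltac:(lra)) as [T HT].
  destruct (HT (Rmin T 0) (Rmin_l _ _)) as [z [Lz Hz]].
  assert (A := Hlip (psi (Rmin T 0) y) z); rewrite (HL0 z Lz) in A.
  assert (B := Hmon y _ 0 (Rmin_r T 0)); rewrite (flow_0 dY psi Hpsi) in B.
  assert (C := Rle_lt_trans _ _ _ A Hz); apply Rabs_def2 in C; lra. }
assert (Hesc : forall y, (forall T, exists t, t <= T /\ -1/2 <= lev (psi t y)) ->
  y = omega \/ L y \/ W y).
{ intros y Hy; destruct (classic (y = omega)); auto.
  destruct (Hback y H) as [Wy|Wy]; auto.
  exfalso; destruct (Wy (1/2) ltac:(lra)) as [T HT].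
  destruct (Hy T) as [t [Ht Hlt]].
  assert (A := Hlip (psi t y) alpha); assert (B := HT t Ht); rewrite Ha in A.
  assert (C := Rle_lt_trans _ _ _ A B); apply Rabs_def2 in C; lra. }
split.
- intros y t [->|[Ly|Wy]] _.
  + left; apply Hof.
  + right; left; auto.
  + right; right; apply HW; apply HW in Wy.
    intros eps He; destruct (Wy eps He) as [T HT]; exists (T - t); intros s Hs.
    rewrite (flow_add dY) by auto; apply HT; lra.
- exists (fun y => -1/2 <= lev y); split; [split; [|split]|].
  + apply (compact_closed_subset dY (fun _ => True)); auto.
    apply (Hopen (fun r => ~ -1/2 <= r)).
    intros r Hr; exists (-1/2 - r); split; [lra|]; intros r' Hr'.
    apply Rabs_def2 in Hr'; lra.
  + exists (fun y => -1/2 < lev y); split; [|split].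
    * apply (Hopen (fun r => -1/2 < r)).
      intros r Hr; exists (r + 1/2); split; [lra|]; intros r' Hr'.
      apply Rabs_def2 in Hr'; lra.
    * intros y [->|[Ly|Wy]]; [lra| |].
      -- rewrite (HL0 y Ly); lra.
      -- assert (A := HWlev y Wy); lra.
    * intros y Hy; lra.
  + intros y Hy; apply Hesc; intros T; exists T; split; [lra|]; apply Hy; auto.
  + intros y Hy Hn; apply NNPP; intros Hne; apply Hn, Hesc; intros T.
    (* The bound -1 makes the exit time negative, as the definition of an attractor demands. *)
    exists (Rmin T (-1)); split; [apply Rmin_l|].
    apply NNPP; intros Hlt; apply Hne; exists (Rmin T (-1)); repeat split; auto.
    assert (A := Rmin_r T (-1)); lra.
Qed.

(** The distances to [alpha] and [omega] are functions of the level, so convergence to the ends can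
    be read off from it. Reversing time and negating [lev] exchanges the two ends and halves the
    work. *)
Lemma lyapunov_universe {Y} (dY : Y -> Y -> R) (psi : R -> Y -> Y) (lev : Y -> R)
    (L : Y -> Prop) (alpha omega : Y) :
  is_metric dY -> is_compact dY (fun _ => True) -> is_flow dY psi ->
  (forall y z, Rabs (lev y - lev z) <= dY y z) ->
  (forall y s t, s <= t -> lev (psi s y) <= lev (psi t y)) ->
  (forall y, dY y alpha = 1 + lev y) -> (forall y, dY y omega = 1 - lev y) ->
  lev alpha = -1 -> lev omega = 1 ->
  (forall t, psi t alpha = alpha) -> (forall t, psi t omega = omega) ->
  (forall y, L y -> lev y = 0) ->
  (forall y t, L y -> L (psi t y)) ->
  (forall y, -1 < lev y < 1 -> (forall t, lev (psi t y) = lev y) -> L y) ->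
  let La := fun y => y = alpha \/ L y \/ Ws dY psi L y in
  let Lo := fun y => y = omega \/ L y \/ Wu dY psi L y in
  (forall y, y <> alpha -> tends_to_set_pinf dY (fun t => psi t y) L \/
     tends_to_pinf dY (fun t => psi t y) omega) /\
  (forall y, y <> omega -> tends_to_set_minf dY (fun t => psi t y) L \/
     tends_to_minf dY (fun t => psi t y) alpha) /\
  is_repeller dY (fun _ _ => True) psi La /\
  is_attractor dY (fun _ _ => True) psi Lo /\
  (forall y, (La y /\ Lo y) <-> L y).
Proof.
intros Hd HY Hpsi Hlip Hmon Hda Hdo Ha Ho Haf Hof HL0 HLinv Hconst La Lo.
assert (Hrev := flow_reverse dY psi Hpsi).
assert (Hlip' : forall y z, Rabs (- lev y - - lev z) <= dY y z).
{ intros y z; replace (- lev y - - lev z) with (- (lev y - lev z)) by ring.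
  rewrite Rabs_Ropp; auto. }
assert (Hmon' : forall y s t, s <= t -> - lev (psi (- s) y) <= - lev (psi (- t) y)).
{ intros y s t Hst; apply Ropp_le_contravar, Hmon; lra. }
assert (Hna : forall y, y <> alpha -> -1 < lev y).
{ intros y Hy; assert (A := metric_nonneg dY y alpha Hd).
  destruct (Req_dec (dY y alpha) 0) as [E|E]; [apply Hd in E; contradiction|].
  rewrite Hda in *; lra. }
assert (Hno : forall y, y <> omega -> lev y < 1).
{ intros y Hy; assert (A := metric_nonneg dY y omega Hd).
  destruct (Req_dec (dY y omega) 0) as [E|E]; [apply Hd in E; contradiction|].
  rewrite Hdo in *; lra. }
assert (Hfwd : forall y, y <> alpha -> tends_to_set_pinf dY (fun t => psi t y) L \/
     tends_to_pinf dY (fun t => psi t y) omega).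
{ intros y Hy; apply (lyapunov_limit dY psi lev); auto. }
assert (Hbwd : forall y, y <> omega -> tends_to_set_minf dY (fun t => psi t y) L \/
     tends_to_minf dY (fun t => psi t y) alpha).
{ intros y Hy; rewrite <- tends_to_set_reverse, <- tends_to_reverse.
  apply (lyapunov_limit dY (fun t x => psi (- t) x) (fun y => - lev y)); auto.
  - intros z; rewrite Hda; ring.
  - intros z Hz Hc; apply Hconst; [lra|]; intros t; specialize (Hc (- t)).
    rewrite Ropp_involutive in Hc; lra.
  - specialize (Hno y Hy); lra. }
split; [auto|split; [auto|split; [|split; [|intros y; split]]]].
- apply (level_attractor dY (fun t x => psi (- t) x) (fun y => - lev y) L
    (Ws dY psi L) omega alpha); auto; try lra.
  + intros y Ly; rewrite (HL0 y Ly); ring.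
  + intros y Hy; destruct (Hfwd y Hy) as [H|H]; [left; exact H|right].
    intros eps He; destruct (H eps He) as [T HT]; exists (- T); intros t Ht; apply HT; lra.
  + intros y; unfold Ws, Wu; rewrite <- tends_to_set_reverse.
    split; intros H eps He; destruct (H eps He) as [T HT]; exists T; intros t Ht.
    * rewrite Ropp_involutive; auto.
    * rewrite <- (Ropp_involutive t); auto.
- apply (level_attractor dY psi lev L (Wu dY psi L) alpha omega); auto; try tauto.
- intros [Hla Hlo].
  assert (HWs : L y \/ Ws dY psi L y -> lev y <= 0).
  { intros [Ly|Wy]; [rewrite HL0; auto; lra|].
    apply Rnot_lt_le; intros Hlt; destruct (Wy (lev y) Hlt) as [T HT].
    destruct (HT (Rmax T 0) (Rmax_l _ _)) as [z [Lz Hz]].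
    assert (A := Rle_lt_trans _ _ _ (Hlip (psi (Rmax T 0) y) z) Hz).
    rewrite (HL0 z Lz) in A; apply Rabs_def2 in A.
    assert (B := Hmon y 0 _ (Rmax_r T 0)); rewrite (flow_0 dY psi Hpsi) in B; lra. }
  assert (HWu : L y \/ Wu dY psi L y -> 0 <= lev y).
  { intros [Ly|Wy]; [rewrite HL0; auto; lra|].
    apply Rnot_lt_le; intros Hlt; destruct (Wy (- lev y) ltac:(lra)) as [T HT].
    destruct (HT (Rmin T 0) (Rmin_l _ _)) as [z [Lz Hz]].
    assert (A := Rle_lt_trans _ _ _ (Hlip (psi (Rmin T 0) y) z) Hz).
    rewrite (HL0 z Lz) in A; apply Rabs_def2 in A.
    assert (B := Hmon y _ 0 (Rmin_r T 0)); rewrite (flow_0 dY psi Hpsi) in B; lra. }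
  destruct Hla as [->|[Ly|Hws]]; auto.
  { destruct Hlo as [E|H]; [rewrite E in Ha; lra|]. specialize (HWu H); lra. }
  destruct Hlo as [->|[Ly|Hwu]]; auto.
  { specialize (HWs (or_intror Hws)); lra. }
  (* The level tends to 0 in both time directions and is monotone, so it is 0 along the whole
     orbit. *)
  assert (E : lev y = 0) by (apply Rle_antisym; auto).
  apply Hconst; [lra|]; intros t; rewrite E; apply Rle_antisym.
  + apply Rnot_lt_le; intros Hlt; destruct (Hws _ Hlt) as [T HT].
    destruct (HT (Rmax T t) (Rmax_l _ _)) as [z [Lz Hz]].
    assert (A := Rle_lt_trans _ _ _ (Hlip (psi (Rmax T t) y) z) Hz).
    rewrite (HL0 z Lz) in A; apply Rabs_def2 in A.
    assert (B := Hmon y t _ (Rmax_r T t)); lra.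
  + apply Rnot_lt_le; intros Hlt; destruct (Hwu (- lev (psi t y)) ltac:(lra)) as [T HT].
    destruct (HT (Rmin T t) (Rmin_l _ _)) as [z [Lz Hz]].
    assert (A := Rle_lt_trans _ _ _ (Hlip (psi (Rmin T t) y) z) Hz).
    rewrite (HL0 z Lz) in A; apply Rabs_def2 in A.
    assert (B := Hmon y _ t (Rmin_r T t)); lra.
- intros Ly; split; right; left; auto.
Qed.

(** * The skew product on the double cone *)

(** The [Rmax] continues the field by 0 beyond the ends, which makes it Lipschitz in [m] on the
    whole line. *)
Definition climb (m v : R) : R := Rmax 0 (1 - Rabs m) * (Rabs m + v).

Lemma climb_nonneg m v : 0 <= v -> 0 <= climb m v.
Proof.
intros Hv; apply Rmult_le_pos; [apply Rmax_l|]; assert (A := Rabs_pos m); lra.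
Qed.

Lemma climb_end m v : Rabs m = 1 -> climb m v = 0.
Proof. intros H; unfold climb; rewrite H, Rminus_diag, Rmax_left by lra; ring. Qed.

Lemma climb_le_2 m v : 0 <= v <= 1 -> climb m v <= 2.
Proof.
intros Hv; unfold climb; assert (A := Rabs_pos m).
unfold Rmax; destruct Rle_dec; [|lra].
apply Rle_trans with (1 * 2); [apply Rmult_le_compat|]; lra.
Qed.

Lemma climb_lip_r m v v' : Rabs (climb m v - climb m v') <= Rabs (v - v').
Proof.
unfold climb; replace (_ - _) with (Rmax 0 (1 - Rabs m) * (v - v')) by ring.
rewrite Rabs_mult; rewrite <- (Rmult_1_l (Rabs (v - v'))) at 2.
apply Rmult_le_compat_r; [apply Rabs_pos|].
rewrite Rabs_right by apply Rle_ge, Rmax_l.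
apply Rmax_lub; [lra|]; assert (A := Rabs_pos m); lra.
Qed.

Lemma climb_lip_l m m' v : 0 <= v <= 1 -> Rabs (climb m v - climb m' v) <= 3 * Rabs (m - m').
Proof.
intros Hv; apply Rle_trans with (3 * Rabs (Rabs m - Rabs m')).
2: { apply Rmult_le_compat_l; [lra|apply Rabs_triang_inv2]. }
unfold climb; assert (A := Rabs_pos m); assert (A' := Rabs_pos m').
revert A A'; generalize (Rabs m) as a; generalize (Rabs m') as b; intros b a Ha Hb.
assert (E : forall a b, 0 <= a -> 0 <= b -> a <= b ->
  Rabs (Rmax 0 (1 - a) * (a + v) - Rmax 0 (1 - b) * (b + v)) <= 3 * (b - a)).
{ clear a b Ha Hb; intros a b Ha Hb Hab.
  unfold Rmax; do 2 destruct Rle_dec; apply Rabs_le; split; try nra. }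
destruct (Rle_dec a b).
- rewrite (Rabs_minus_sym a b), (Rabs_right (b - a)) by lra; auto.
- rewrite Rabs_minus_sym, (Rabs_right (a - b)) by lra; apply E; lra.
Qed.

(** If both minima on the right are base distances, these add up; if [1 - Rabs m1] or [1 - Rabs m3]
    occurs, it bounds the minimum on the left. There remains [1 - Rabs m2], which is compared with
    one of the outer two using the slack in the level differences. The alternative [Rabs m2 = 1]
    covers a middle point at an end, where no base point exists. *)
Lemma min_metric_triangle m1 m2 m3 d12 d23 d13 :
  Rabs m1 <= 1 -> Rabs m2 <= 1 -> Rabs m3 <= 1 ->
  0 <= d12 -> 0 <= d23 -> 0 <= d13 -> d13 <= d12 + d23 \/ Rabs m2 = 1 ->
  Rabs (m1 - m3) + Rmin d13 (Rmin (1 - Rabs m1) (1 - Rabs m3)) <=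
  (Rabs (m1 - m2) + Rmin d12 (Rmin (1 - Rabs m1) (1 - Rabs m2))) +
  (Rabs (m2 - m3) + Rmin d23 (Rmin (1 - Rabs m2) (1 - Rabs m3))).
Proof.
intros H1 H2 H3 P1 P2 P3 H.
assert (T : Rabs (m1 - m3) <= Rabs (m1 - m2) + Rabs (m2 - m3)).
{ replace (m1 - m3) with ((m1 - m2) + (m2 - m3)) by ring; apply Rabs_triang. }
(* either [m2] lies between [m1] and [m3], or the triangle inequality for levels is strict *)
assert (S : Rabs m2 + Rabs (m1 - m3) <= Rabs m1 + Rabs (m1 - m2) + Rabs (m2 - m3) \/
            Rabs m2 + Rabs (m1 - m3) <= Rabs m3 + Rabs (m1 - m2) + Rabs (m2 - m3)).
{ unfold Rabs; repeat destruct Rcase_abs; lra. }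
set (c1 := 1 - Rabs m1) in *; set (c2 := 1 - Rabs m2) in *; set (c3 := 1 - Rabs m3) in *.
set (l := Rmin d13 (Rmin c1 c3)).
assert (L1 : l <= d13) by apply Rmin_l.
assert (L2 : l <= c1) by (eapply Rle_trans; [apply Rmin_r|apply Rmin_l]).
assert (L3 : l <= c3) by (eapply Rle_trans; [apply Rmin_r|apply Rmin_r]).
unfold Rmin; repeat destruct Rle_dec; unfold c1, c2, c3 in *; lra.
Qed.

Section Cone.

Context {X : Type} (d : X -> X -> R) (N : X -> Prop).
Hypothesis Hd : is_metric d.
Hypothesis HN : is_compact d N.

(* The double cone [N x [-1,1]] with each end collapsed: the ends are [(None, -1)] and [(None, 1)]. *)
Definition cone : Type := { p : option X * R |
  match fst p with Some x => N x /\ Rabs (snd p) < 1 | None => Rabs (snd p) = 1 end }.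

Definition level (y : cone) : R := snd (proj1_sig y).

(** The default 0 is harmless: at an end the cap [1 - Rabs (level y)] in [cone_dist] vanishes as
    well. *)
Definition base_dist (o o' : option X) : R :=
  match o, o' with Some x, Some x' => d x x' | _, _ => 0 end.

(** Capping the base distance by the level distances to the ends shrinks the slices to a point
    there, and the distance to an end is exactly a difference of levels. *)
Definition cone_dist (y z : cone) : R :=
  Rabs (level y - level z) +
  Rmin (base_dist (fst (proj1_sig y)) (fst (proj1_sig z)))
       (Rmin (1 - Rabs (level y)) (1 - Rabs (level z))).

Lemma cone_eq (y z : cone) : proj1_sig y = proj1_sig z -> y = z.
Proof. apply eq_sig_hprop; intros; apply proof_irrelevance. Qed.

Lemma level_bound y : Rabs (level y) <= 1.
Proof.
destruct y as [[[x|] m] Hy]; unfold level; simpl in *; [destruct Hy|]; lra.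
Qed.

Lemma base_dist_nonneg o o' : 0 <= base_dist o o'.
Proof. destruct o, o'; simpl; try lra; apply metric_nonneg; auto. Qed.

Lemma base_dist_sym o o' : base_dist o o' = base_dist o' o.
Proof. destruct o, o'; simpl; auto; apply metric_sym; auto. Qed.

Lemma level_lip y z : Rabs (level y - level z) <= cone_dist y z.
Proof.
unfold cone_dist; assert (A := level_bound y); assert (B := level_bound z).
assert (C := base_dist_nonneg (fst (proj1_sig y)) (fst (proj1_sig z))).
assert (0 <= Rmin (base_dist (fst (proj1_sig y)) (fst (proj1_sig z)))
  (Rmin (1 - Rabs (level y)) (1 - Rabs (level z)))); [|lra].
repeat apply Rmin_glb; lra.
Qed.

Lemma cone_dist_le y z : cone_dist y z <=
  Rabs (level y - level z) + base_dist (fst (proj1_sig y)) (fst (proj1_sig z)).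
Proof. apply Rplus_le_compat_l, Rmin_l. Qed.

Lemma cone_dist_end y z : Rabs (level z) = 1 -> cone_dist y z = Rabs (level y - level z).
Proof.
intros H; unfold cone_dist; rewrite H, Rminus_diag.
assert (A := level_bound y).
assert (C := base_dist_nonneg (fst (proj1_sig y)) (fst (proj1_sig z))).
rewrite (Rmin_right (1 - Rabs (level y))), Rmin_right by lra; ring.
Qed.

Lemma cone_metric : is_metric cone_dist.
Proof.
split; [|split; [|split]].
- intros y z; eapply Rle_trans; [apply Rabs_pos|apply level_lip].
- intros y z; split.
  + intros H; assert (A := level_lip y z).
    assert (E : level y = level z).
    { assert (B := Rabs_pos (level y - level z)).
      destruct (Req_dec (level y - level z) 0); [lra|].
      apply Rabs_no_R0 in H0; lra. }
    assert (H' := H); unfold cone_dist in H'; rewrite E, Rminus_diag, Rabs_R0, Rplus_0_l in H'.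
    apply cone_eq; destruct y as [[[x|] m] Hy], z as [[[x'|] m'] Hz]; unfold level in *;
      simpl in *; subst m'; try lra; auto.
    destruct (Req_dec (d x x') 0) as [E|E].
    * apply Hd in E; subst; auto.
    * assert (B := metric_nonneg d x x' Hd); destruct Hy.
      revert H'; unfold Rmin; repeat destruct Rle_dec; lra.
  + intros ->; unfold cone_dist; rewrite Rminus_diag, Rabs_R0.
    assert (A := level_bound z).
    replace (base_dist _ _) with 0.
    * rewrite Rmin_left; [ring|]; apply Rmin_glb; lra.
    * destruct (fst (proj1_sig z)); simpl; auto; symmetry; apply metric_refl; auto.
- intros y z; unfold cone_dist; rewrite Rabs_minus_sym, base_dist_sym, (Rmin_comm (1 - _)); auto.
- intros x y z; apply min_metric_triangle; try apply level_bound; try apply base_dist_nonneg.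
  destruct x as [[[x|] m1] H1], y as [[[y|] m2] H2], z as [[[z|] m3] H3];
    unfold level; simpl in *; try lra.
  + left; apply metric_triangle; auto.
  + left; assert (A := metric_nonneg d x y Hd); lra.
  + left; assert (A := metric_nonneg d y z Hd); lra.
Qed.

Definition cone_end (c : R) (Hc : Rabs c = 1) : cone := exist _ (None, c) Hc.

Definition cone_point (x : X) (m : R) (Hx : N x) (Hm : Rabs m < 1) : cone :=
  exist _ (Some x, m) (conj Hx Hm).

(** The tube lemma around the slice at level [m]: for [Rabs m = 1] the slice is one point, otherwise
    a copy of the compact [N], covered by boxes that each lie in one [U i]. *)
Lemma cone_cover_level (I : Type) (U : I -> cone -> Prop) (m : R) :
  (forall i, is_open cone_dist (U i)) -> (forall y, exists i, U i y) -> Rabs m <= 1 ->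
  exists l del, 0 < del /\
    forall y, Rabs (level y - m) < del -> exists i, In i l /\ U i y.
Proof.
intros HU Hcov Hm.
destruct (Req_dec (Rabs m) 1) as [E|E].
- destruct (Hcov (cone_end m E)) as [i Hi].
  destruct (HU i _ Hi) as [e [He H]].
  exists (i :: nil), e; split; auto; intros y Hy; exists i; split; [left; auto|].
  apply H; rewrite (metric_sym _ _ _ cone_metric), cone_dist_end; auto.
- assert (Hm1 : Rabs m < 1) by lra.
  set (V := fun (j : X * I * R) x' => let '(p, i, r) := j in 0 < r /\ d p x' < r /\
    forall y : cone, forall x m', proj1_sig y = (Some x, m') -> d p x < r -> Rabs (m' - m) < r ->
    U i y).
  destruct (HN _ V) as [l Hl].
  + intros [[p i] r] x [Hr [Hx H]]; exists (r - d p x); split; [lra|]; intros x' Hx'.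
    split; auto; split; auto; assert (A := metric_triangle d p x x' Hd); lra.
  + intros x Nx; destruct (Hcov (cone_point x m Nx Hm1)) as [i Hi].
    destruct (HU i _ Hi) as [e [He H]].
    exists (x, i, e / 2); split; [lra|]; split; [rewrite metric_refl; auto; lra|].
    intros y x' m' Hy Hx' Hm'; apply H.
    eapply Rle_lt_trans; [apply cone_dist_le|].
    unfold level; rewrite Hy; simpl. rewrite Rabs_minus_sym; lra.
  (* Entries with a radius that is not positive index empty sets; replacing it by 1 keeps the
     minimum positive. *)
  + destruct (list_lower_bound_pos (fun j : X * I * R => if Rlt_dec 0 (snd j) then snd j else 1) l)
      as [r0 [Hr0 Hr]].
    { intros j _; destruct Rlt_dec; lra. }
    exists (map (fun j => snd (fst j)) l), (Rmin r0 (1 - Rabs m)).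
    split; [apply Rmin_pos; lra|]; intros y Hy.
    assert (L1 := Rmin_l r0 (1 - Rabs m)). assert (L2 := Rmin_r r0 (1 - Rabs m)).
    destruct (proj1_sig y) as [[x|] m'] eqn:Ey.
    * assert (Nx : N x) by (assert (P := proj2_sig y); simpl in P; rewrite Ey in P; apply P).
      destruct (Hl x Nx) as [[[p i] r] [Hin [Hrp [Hpx H]]]].
      exists i; split; [apply in_map_iff; exists (p, i, r); auto|].
      apply (H y x m' Ey Hpx).
      assert (Hm' : level y = m') by (unfold level; rewrite Ey; auto).
      specialize (Hr _ Hin); simpl in Hr; destruct Rlt_dec; [|contradiction].
      rewrite <- Hm'; lra.
    (* An end is at least [1 - Rabs m] away in level. *)
    * exfalso; assert (P := proj2_sig y); simpl in P; rewrite Ey in P; simpl in P.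
      assert (Hm' : level y = m') by (unfold level; rewrite Ey; auto).
      rewrite Hm' in Hy; assert (A := Rabs_triang_inv m' m); lra.
Qed.

Lemma cone_compact : is_compact cone_dist (fun _ => True).
Proof.
intros I U HU Hcov.
assert (H : exists l : list I, forall y, -1 <= level y <= 1 -> exists i, In i l /\ U i y).
{ apply (interval_induction (fun u v => exists l : list I, forall y, u <= level y <= v ->
    exists i, In i l /\ U i y)); [lra| |].
  - intros u v w _ [l1 H1] [l2 H2]; exists (l1 ++ l2); intros y Hy.
    destruct (Rle_dec (level y) v).
    + destruct (H1 y) as [i [Hi Ui]]; [lra|]; exists i; split; auto; apply in_or_app; auto.
    + destruct (H2 y) as [i [Hi Ui]]; [lra|]; exists i; split; auto; apply in_or_app; auto.
  - intros m Hm; destruct (cone_cover_level I U m) as [l [del [Hdel Hl]]]; auto.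
    { apply Rabs_le; lra. }
    exists del; split; auto; intros u v Hu Huv Hv; exists l; intros y Hy; apply Hl.
    apply Rabs_def1; lra. }
destruct H as [l Hl]; exists l; intros y _; apply Hl.
apply Rabs_le_between, level_bound.
Qed.

(** * The skew-product flow on the cone *)

Context (theta : R -> X -> X) (g : X -> R).
Hypothesis theta_0 : forall x, theta 0 x = x.
Hypothesis theta_add : forall s t x, theta s (theta t x) = theta (s + t) x.
Hypothesis theta_N : forall t x, N x -> N (theta t x).
Hypothesis theta_cont : forall t x eps, N x -> 0 < eps -> exists delta, 0 < delta /\
  forall s y, Rabs (s - t) < delta -> d x y < delta -> d (theta t x) (theta s y) < eps.
Hypothesis g_bound : forall x, 0 <= g x <= 1.
Hypothesis g_lip : forall x y, Rabs (g x - g y) <= d x y.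

(** Continuity of [theta] is available on [N] only, hence the guard; it leaves [height] total. *)
Lemma height_exists x m : exists f, f 0 = m /\
  (N x -> forall t, is_derive f t (climb (f t) (g (theta t x)))).
Proof.
destruct (classic (N x)) as [Nx|Nx]; [|exists (fun _ => m); split; tauto].
destruct (picard_lindelof (fun t u => climb u (g (theta t x))) 3 2 m) as [f [H0 Hf]].
- lra.
- intros t u v; apply climb_lip_l, g_bound.
- intros u t eps He; destruct (theta_cont t x eps Nx He) as [del [Hdel H]].
  exists del; split; auto; intros s Hs.
  eapply Rle_lt_trans; [apply climb_lip_r|].
  eapply Rle_lt_trans; [apply g_lip|].
  rewrite metric_sym by auto; apply H; auto; rewrite metric_refl; auto.
- intros t; rewrite Rabs_right; [apply climb_le_2, g_bound|].
  apply Rle_ge, climb_nonneg, g_bound.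
- exists f; split; auto.
Qed.

Definition height (x : X) (m : R) : R -> R :=
  proj1_sig (constructive_indefinite_description _ (height_exists x m)).

Lemma height_0 x m : height x m 0 = m.
Proof. unfold height; destruct constructive_indefinite_description as [f Hf]; apply Hf. Qed.

Lemma height_derive x m t : N x ->
  is_derive (height x m) t (climb (height x m t) (g (theta t x))).
Proof.
intros Nx; unfold height; destruct constructive_indefinite_description as [f Hf].
apply (proj2 Hf Nx).
Qed.

Lemma height_shift_derive x m a t : N x ->
  is_derive (fun t => height x m (t + a)) t (climb (height x m (t + a)) (g (theta (t + a) x))).
Proof.
intros Nx.
assert (D := is_derive_comp (height x m) (fun t => t + a) t _ 1 (height_derive x m (t + a) Nx)).
evar_last; [apply D|unfold scal; simpl; unfold mult; simpl; ring].
auto_derive; auto.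
Qed.

Lemma height_shift x m s t : N x ->
  height (theta t x) (height x m t) s = height x m (s + t).
Proof.
intros Nx.
apply (ode_unique (height (theta t x) (height x m t)) (fun s => height x m (s + t))
  (fun s => climb (height (theta t x) (height x m t) s) (g (theta (s + t) x)))
  (fun s => climb (height x m (s + t)) (g (theta (s + t) x))) 3).
- intros r; rewrite <- theta_add; apply height_derive; auto.
- intros r; apply height_shift_derive; auto.
- lra.
- rewrite height_0, Rplus_0_l; auto.
- intros r _; apply climb_lip_l, g_bound.
Qed.

(** The constants 1 and -1 are solutions, so by uniqueness no other level reaches them in finite
    time. *)
Lemma height_end x m t c : N x -> Rabs c = 1 -> height x m t = c -> m = c.
Proof.
intros Nx Hc Ht.
assert (E : (fun s => height x m (s + t)) (- t) = (fun _ => c) (- t)).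
{ apply (ode_unique (fun s => height x m (s + t)) (fun _ => c)
    (fun s => climb (height x m (s + t)) (g (theta (s + t) x))) (fun _ => 0) 3).
  - intros r; apply height_shift_derive; auto.
  - intros r; apply is_derive_cst.
  - lra.
  - rewrite Rplus_0_l; auto.
  - intros r _; rewrite <- (climb_end c (g (theta (r + t) x)) Hc).
    apply climb_lip_l, g_bound. }
simpl in E; rewrite Rplus_opp_l, height_0 in E; auto.
Qed.

Lemma height_bound x m t : N x -> Rabs m < 1 -> Rabs (height x m t) < 1.
Proof.
intros Nx Hm; apply Rnot_le_lt; intros Ht.
assert (Hcont : continuity (height x m)).
{ intros s; apply cont_continuity_pt.
  apply (derive_cont _ (fun t => climb (height x m t) (g (theta t x)))).
  intros r; apply height_derive; auto. }
assert (A := Rabs_def2 _ _ Hm).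
assert (H : forall c, Rabs c = 1 -> Rmin m (height x m t) <= c <= Rmax m (height x m t) -> False).
{ intros c Hc Hb; destruct (IVT_gen (height x m) 0 t c Hcont) as [s [_ Hs]].
  - rewrite height_0; auto.
  - apply height_end in Hs; auto; subst; lra. }
destruct (Rle_dec 0 (height x m t)) as [H0|H0].
- rewrite Rabs_right in Ht by lra; apply (H 1); [apply Rabs_R1|].
  rewrite Rmin_left, Rmax_right by lra; lra.
- rewrite Rabs_left in Ht by lra; apply (H (-1)); [rewrite Rabs_left; lra|].
  rewrite Rmin_right, Rmax_left by lra; lra.
Qed.

Lemma height_incr x m s t : N x -> s <= t -> height x m s <= height x m t.
Proof.
intros Nx Hst; apply (derive_nonneg_le _ (fun t => climb (height x m t) (g (theta t x)))); auto.
- intros r; apply height_derive; auto.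
- intros r _; apply climb_nonneg, g_bound.
Qed.

Lemma height_const x m : N x -> Rabs m < 1 -> (forall t, height x m t = m) ->
  m = 0 /\ forall t, g (theta t x) = 0.
Proof.
intros Nx Hm Hc.
assert (H : forall t, Rabs m + g (theta t x) = 0).
{ intros t; assert (D := height_derive x m t Nx).
  assert (D' : is_derive (height x m) t 0).
  { apply (is_derive_ext (fun _ => m)); [intros; symmetry; apply Hc|apply is_derive_cst]. }
  assert (E := is_derive_unique (height x m : R -> R) _ _ D).
  rewrite (is_derive_unique (height x m : R -> R) _ _ D'), Hc in E.
  unfold climb in E; rewrite Rmax_right in E by lra.
  symmetry in E; apply Rmult_integral in E; lra. }
assert (A := Rabs_pos m); split.
- assert (B := H 0); assert (C := g_bound (theta 0 x)).
  destruct (Req_dec m 0) as [|E]; auto; apply Rabs_pos_lt in E; lra.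
- intros t; specialize (H t); assert (C := g_bound (theta t x)); lra.
Qed.

Lemma height_zero x t : N x ->
  (forall s, Rmin 0 t <= s <= Rmax 0 t -> g (theta s x) = 0) -> height x 0 t = 0.
Proof.
intros Nx Hg.
apply (ode_unique (height x 0) (fun _ => 0) (fun t => climb (height x 0 t) (g (theta t x)))
  (fun _ => 0) 3).
- intros r; apply height_derive; auto.
- intros r; apply is_derive_cst.
- lra.
- apply height_0.
- intros s Hs; rewrite (Hg s Hs).
  assert (E : climb 0 0 = 0) by (unfold climb; rewrite Rabs_R0; ring).
  assert (A := climb_lip_l (height x 0 s) 0 0 ltac:(lra)); rewrite E in A; exact A.
Qed.

(** Base orbits stay uniformly close on the time interval, and [climb] and [g] pass this on as a
    perturbation of at most [eta] in the level equation. *)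
Lemma height_close x m T eps : N x -> 0 < eps -> exists delta, 0 < delta /\
  forall y m' t, N y -> Rabs t <= T -> d x y < delta -> Rabs (m - m') < delta ->
  Rabs (height x m t - height y m' t) < eps.
Proof.
intros Nx He.
destruct (Rle_dec 0 T) as [HT|HT].
2: { exists 1; split; [lra|]; intros y m' t _ Ht; assert (A := Rabs_pos t); lra. }
destruct (gronwall_small 3 T eps ltac:(lra) He) as [eta [Heta Hg]].
destruct (tube d (fun s y => d (theta s x) (theta s y) < eta) (- T) T x) as [del [Hdel H]].
- lra.
- intros s _; destruct (theta_cont s x (eta / 2) Nx ltac:(lra)) as [del [Hdel H]].
  exists del; split; auto; intros s' y Hs' Hy.
  assert (A1 := H s' y Hs' Hy).
  assert (A2 := H s' x Hs' ltac:(rewrite metric_refl; auto)).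
  assert (A3 := metric_triangle d (theta s' x) (theta s x) (theta s' y) Hd).
  rewrite (metric_sym d (theta s' x) (theta s x)) in A3 by auto; lra.
- exists (Rmin del eta); split; [apply Rmin_pos; auto|]; intros y m' t Ny Ht Hy Hm.
  assert (L1 := Rmin_l del eta). assert (L2 := Rmin_r del eta).
  apply (Hg _ _ (fun s => climb (height x m s) (g (theta s x)))
    (fun s => climb (height y m' s) (g (theta s y)))); auto.
  + intros s; apply height_derive; auto.
  + intros s; apply height_derive; auto.
  + rewrite !height_0; lra.
  + intros s Hs; apply Rabs_le_between in Hs.
    set (u := height x m s); set (v := height y m' s).
    replace (climb u (g (theta s x)) - climb v (g (theta s y))) with
      ((climb u (g (theta s x)) - climb v (g (theta s x))) +
       (climb v (g (theta s x)) - climb v (g (theta s y)))) by ring.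
    eapply Rle_trans; [apply Rabs_triang|].
    assert (A1 := climb_lip_l u v (g (theta s x)) (g_bound _)).
    assert (A2 := climb_lip_r v (g (theta s x)) (g (theta s y))).
    assert (A3 := g_lip (theta s x) (theta s y)).
    assert (A4 := H s y Hs ltac:(lra)). simpl in A4. lra.
Qed.

(** The estimate is uniform in [x], as continuity at an end requires, since closeness to an end says
    nothing about the base point; it holds because [climb] vanishes there for every value of [g]. *)
Lemma height_near_end c T eps : Rabs c = 1 -> 0 < eps -> exists delta, 0 < delta /\
  forall x m t, N x -> Rabs t <= T -> Rabs (c - m) < delta -> Rabs (c - height x m t) < eps.
Proof.
intros Hc He.
destruct (gronwall_small 3 T eps ltac:(lra) He) as [eta [Heta Hg]].
exists eta; split; auto; intros x m t Nx Ht Hm.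
apply (Hg (fun _ => c) (height x m) (fun _ => 0)
  (fun t => climb (height x m t) (g (theta t x)))); auto.
- intros s; apply is_derive_cst.
- intros s; apply height_derive; auto.
- rewrite height_0; lra.
- intros s _; rewrite <- (climb_end c (g (theta s x)) Hc).
  assert (A := climb_lip_l c (height x m s) (g (theta s x)) (g_bound _)); lra.
Qed.

Definition cone_flow_raw (t : R) (p : option X * R) : option X * R :=
  match p with
  | (Some x, m) => (Some (theta t x), height x m t)
  | (None, m) => (None, m)
  end.

Lemma cone_flow_in t (y : cone) :
  match fst (cone_flow_raw t (proj1_sig y)) with
  | Some x => N x /\ Rabs (snd (cone_flow_raw t (proj1_sig y))) < 1
  | None => Rabs (snd (cone_flow_raw t (proj1_sig y))) = 1
  end.
Proof.
destruct y as [[[x|] m] Hy]; simpl in *; auto.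
destruct Hy; split; [apply theta_N|apply height_bound]; auto.
Qed.

Definition cone_flow (t : R) (y : cone) : cone := exist _ _ (cone_flow_in t y).

Lemma cone_flow_end t c Hc : cone_flow t (cone_end c Hc) = cone_end c Hc.
Proof. apply cone_eq; reflexivity. Qed.

Lemma cone_flow_cont t y eps : 0 < eps -> exists delta, 0 < delta /\
  forall s z, Rabs (s - t) < delta -> cone_dist y z < delta ->
    cone_dist (cone_flow t y) (cone_flow s z) < eps.
Proof.
intros He; destruct y as [[[x|] m] Hy]; simpl in Hy.
- destruct Hy as [Nx Hm].
  assert (Hh : cont (height x m)).
  { apply (derive_cont _ (fun t => climb (height x m t) (g (theta t x)))).
    intros r; apply height_derive; auto. }
  destruct (Hh t (eps / 4) ltac:(lra)) as [d1 [Hd1 H1]].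
  destruct (height_close x m (Rabs t + 1) (eps / 4) Nx ltac:(lra)) as [d2 [Hd2 H2]].
  destruct (theta_cont t x (eps / 2) Nx ltac:(lra)) as [d3 [Hd3 H3]].
  (* The bound [(1 - Rabs m) / 2] keeps both caps in [cone_dist] at least [del], so a cone distance
     below [del] forces the base distance below [del]. *)
  set (del := Rmin (Rmin 1 ((1 - Rabs m) / 2)) (Rmin d1 (Rmin d2 d3))).
  assert (L : del <= 1 /\ del <= (1 - Rabs m) / 2 /\ del <= d1 /\ del <= d2 /\ del <= d3).
  { unfold del; repeat split.
    - eapply Rle_trans; [apply Rmin_l|apply Rmin_l].
    - eapply Rle_trans; [apply Rmin_l|apply Rmin_r].
    - eapply Rle_trans; [apply Rmin_r|apply Rmin_l].
    - eapply Rle_trans; [apply Rmin_r|]; eapply Rle_trans; [apply Rmin_r|apply Rmin_l].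
    - eapply Rle_trans; [apply Rmin_r|]; eapply Rle_trans; [apply Rmin_r|apply Rmin_r]. }
  exists del; split; [unfold del; repeat apply Rmin_pos; lra|].
  intros s z Hs Hz.
  assert (Hlz := Rle_lt_trans _ _ _ (level_lip _ z) Hz).
  destruct z as [[[x'|] m'] Hz']; unfold level in Hlz; simpl in Hlz, Hz'.
  + destruct Hz' as [Nx' Hm'].
    assert (A : Rabs m' < (1 + Rabs m) / 2).
    { rewrite Rabs_minus_sym in Hlz; assert (B := Rabs_triang_inv m' m); lra. }
    assert (Hxx : d x x' < del).
    { apply Rnot_le_lt; intros Hle; revert Hz; apply Rle_not_lt.
      unfold cone_dist, level; simpl.
      assert (B := Rabs_pos (m - m')).
      assert (del <= Rmin (d x x') (Rmin (1 - Rabs m) (1 - Rabs m'))); [|lra].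
      repeat apply Rmin_glb; lra. }
    eapply Rle_lt_trans; [apply cone_dist_le|]; unfold level; simpl.
    assert (B1 := H3 s x' ltac:(lra) ltac:(lra)).
    assert (B2 : Rabs s <= Rabs t + 1).
    { replace s with (t + (s - t)) by ring; eapply Rle_trans; [apply Rabs_triang|lra]. }
    assert (B3 := H2 x' m' s Nx' B2 ltac:(lra) ltac:(lra)).
    assert (B4 := H1 s ltac:(lra)).
    replace (height x m t - height x' m' s) with
      (- (height x m s - height x m t) + (height x m s - height x' m' s)) by ring.
    assert (B5 := Rabs_triang (- (height x m s - height x m t)) (height x m s - height x' m' s)).
    rewrite Rabs_Ropp in B5; lra.
  + exfalso; rewrite Rabs_minus_sym in Hlz; assert (B := Rabs_triang_inv m' m); lra.
- destruct (height_near_end m (Rabs t + 1) eps Hy He) as [del [Hdel H]].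
  exists (Rmin 1 (Rmin eps del)); split; [repeat apply Rmin_pos; lra|]; intros s z Hs Hz.
  assert (L1 := Rmin_l 1 (Rmin eps del)). assert (L2 := Rmin_r 1 (Rmin eps del)).
  assert (L3 := Rmin_l eps del). assert (L4 := Rmin_r eps del).
  assert (Hlz := Rle_lt_trans _ _ _ (level_lip _ z) Hz).
  rewrite (metric_sym _ _ _ cone_metric), cone_dist_end by auto.
  rewrite Rabs_minus_sym.
  destruct z as [[[x'|] m'] Hz']; unfold level in *; simpl in *.
  + apply H; [apply Hz'| |lra].
    replace s with (t + (s - t)) by ring; eapply Rle_trans; [apply Rabs_triang|lra].
  + lra.
Qed.

Lemma cone_is_flow : is_flow cone_dist cone_flow.
Proof.
apply flow_intro.
- apply cone_flow_cont.
- intros [[[x|] m] Hy]; apply cone_eq; simpl; auto; rewrite theta_0, height_0; auto.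
- intros s t [[[x|] m] Hy]; apply cone_eq; simpl; auto.
  rewrite theta_add, height_shift; auto; apply Hy.
Qed.

Lemma level_incr y s t : s <= t -> level (cone_flow s y) <= level (cone_flow t y).
Proof.
intros Hst; destruct y as [[[x|] m] Hy]; unfold level; simpl in *; [|lra].
apply height_incr; auto; apply Hy.
Qed.

Lemma level_const y : -1 < level y < 1 -> (forall t, level (cone_flow t y) = level y) ->
  exists x, proj1_sig y = (Some x, 0) /\ N x /\ forall t, g (theta t x) = 0.
Proof.
intros Hl Hc; destruct y as [[[x|] m] Hy]; unfold level in *; simpl in *.
- destruct Hy as [Nx Hm]; destruct (height_const x m Nx Hm Hc) as [-> Hg].
  exists x; auto.
- exfalso; revert Hy; unfold Rabs; destruct Rcase_abs; lra.
Qed.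

End Cone.

(** * The isolating universe *)

(** The distance to the complement of [U]; the cap gives the value 1 when the complement is
    empty. *)
Definition depth {X} (d : X -> X -> R) (U : X -> Prop) (x : X) : R :=
  cinf (d x) (fun y => ~ U y).

Lemma depth_nonneg {X} (d : X -> X -> R) U x : is_metric d -> 0 <= depth d U x.
Proof. intros Hd; apply cinf_nonneg; intros; apply metric_nonneg; auto. Qed.

Lemma depth_lip {X} (d : X -> X -> R) U x y : is_metric d ->
  Rabs (depth d U x - depth d U y) <= d x y.
Proof.
intros Hd; apply cinf_close; try (intros; apply metric_nonneg; auto).
intros z _ _; apply Rabs_le.
assert (A := metric_triangle d x y z Hd). assert (B := metric_triangle d y x z Hd).
rewrite (metric_sym d y x) in B by auto; lra.
Qed.

Lemma depth_pos {X} (d : X -> X -> R) U x : is_metric d -> is_open d U ->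
  0 < depth d U x <-> U x.
Proof.
intros Hd HU; split; intros H.
- apply NNPP; intros Hn.
  assert (A : depth d U x <= d x x).
  { apply (cinf_lb (d x)); auto; intros; apply metric_nonneg; auto. }
  rewrite metric_refl in A by auto; lra.
- destruct (HU x H) as [e [He Hy]].
  apply Rlt_le_trans with (Rmin 1 e); [apply Rmin_pos; lra|].
  apply cinf_glb; [intros; apply metric_nonneg; auto|apply Rmin_l|]; intros y Hn.
  apply Rle_trans with (1 := Rmin_r _ _); apply Rnot_lt_le; intros Hlt.
  apply Hn, Hy, Hlt.
Qed.

Lemma depth_open {X} (d : X -> X -> R) U (P : R -> Prop) : is_metric d ->
  (forall r, P r -> exists e, 0 < e /\ forall r', Rabs (r - r') < e -> P r') ->
  is_open d (fun x => P (depth d U x)).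
Proof.
intros Hd HP x Hx; destruct (HP _ Hx) as [e [He H]]; exists e; split; auto.
intros y Hy; apply H; eapply Rle_lt_trans; [apply depth_lip|]; auto.
Qed.

(** A point outside [L] leaves [N] at some time, and so do its neighbors since [N] is closed; by
    invariance none of them is in [L]. *)
Lemma isolated_closed {X} (d : X -> X -> R) Gamma phi L N :
  is_metric d -> is_partial_flow d Gamma phi -> is_invariant Gamma phi L ->
  isolating_nbhd d Gamma phi L N -> is_open d (fun x => ~ L x).
Proof.
intros Hd Hphi Hinv [HN [[U [_ [HLU HUN]]] Hiso]] x Hx.
assert (Ht : exists t, Gamma t x /\ ~ N (phi t x)).
{ apply NNPP; intros Hn; apply Hx, Hiso; intros t Ht; apply NNPP; intros HNt.
  apply Hn; exists t; auto. }
destruct Ht as [t [Ht HNt]].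
destruct (compact_closed d N Hd HN _ HNt) as [e [He H]].
destruct (phi_close d Gamma phi Hd Hphi x t t e) as [del [Hdel Hc]]; auto; [lra|].
exists del; split; auto; intros y Hy Ly.
destruct (Hc t y ltac:(lra) Hy) as [Gy Hxy].
apply (H (phi t y) Hxy), HUN, HLU, Hinv; auto.
Qed.

Theorem mainTheorem1 (X : Type) (d : X -> X -> R) (Gamma : R -> X -> Prop)
  (phi : R -> X -> X) (L : X -> Prop) :
  is_metric d -> is_partial_flow d Gamma phi -> is_isolated d Gamma phi L ->
  exists (N : X -> Prop) (Y : Type) (dY : Y -> Y -> R) (psi : R -> Y -> Y)
         (h : X -> Y) (alpha omega : Y),
    isolating_nbhd d Gamma phi L N /\
    isolating_universe d Gamma phi L N dY psi h alpha omega /\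
    let hL := fun y => exists x, L x /\ h x = y in
    let La := fun y => y = alpha \/ hL y \/ Ws dY psi hL y in
    let Lo := fun y => y = omega \/ hL y \/ Wu dY psi hL y in
    is_repeller dY (fun _ _ => True) psi La /\
    is_attractor dY (fun _ _ => True) psi Lo /\
    (forall y, (La y /\ Lo y) <-> hL y).
Proof.
intros Hd Hphi [Hinv [N HisoN]].
assert (HLclosed := isolated_closed d Gamma phi L N Hd Hphi Hinv HisoN).
destruct HisoN as [HN [[U [HU [HLU HUN]]] Hiso]].
assert (HLc : is_compact d L) by (apply (compact_closed_subset d N); auto).
assert (Hdep : forall x, 0 < depth d U x <-> U x) by (intros; apply depth_pos; auto).
assert (Hdlip : forall x y, Rabs (depth d U x - depth d U y) <= d x y)
  by (intros; apply depth_lip; auto).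
assert (Hgt : forall r, is_open d (fun x => r < depth d U x)).
{ intros r; apply (depth_open d U (fun v => r < v)); auto.
  intros v Hv; exists (v - r); split; [lra|]; intros v' Hv'; apply Rabs_def2 in Hv'; lra. }
(* Depth above [c] on [L] makes [depth >= c] a smaller isolating neighborhood, inside [U]. *)
destruct (compact_lower_bound d L (depth d U)) as [c [Hc HcL]]; auto.
{ intros x Lx; apply Hdep; auto. }
set (N0 := fun x => c <= depth d U x).
assert (HN0U : forall x, N0 x -> U x) by (intros x Hx; apply Hdep; unfold N0 in Hx; lra).
assert (HN0N : forall x, N0 x -> N x) by auto.
assert (HLN0 : forall x, L x -> N0 x) by (intros x Lx; left; apply HcL; auto).
assert (HN0 : is_compact d N0).
{ apply (compact_closed_subset d N); auto.
  apply (depth_open d U (fun v => ~ c <= v)); auto.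
  intros v Hv; exists (c - v); split; [lra|]; intros v' Hv'; apply Rabs_def2 in Hv'; lra. }
destruct (compact_uniform_time d N Gamma) as [t1 [Ht1 H1]]; auto.
{ apply (Gamma_open d Gamma phi Hphi). }
{ intros x _; apply (Gamma_0 d Gamma phi Hphi). }
(* The gap between the depths [c] and [c / 2] yields the time margin around [N0] on which the
   cut-off is at least 1. *)
destruct (compact_uniform_time d N0 (fun s x => Gamma s x /\ c / 2 < depth d U (phi s x)))
  as [t2 [Ht2 H2]]; auto.
{ intros s x [Gs Hs].
  destruct (Gamma_open d Gamma phi Hphi s x Gs) as [e1 [He1 A1]].
  destruct (phi_cont d Gamma phi Hphi s x Gs (depth d U (phi s x) - c / 2)) as [e2 [He2 A2]]; [lra|].
  exists (Rmin e1 e2); split; [apply Rmin_pos; auto|]; intros s' y Hs' Hy.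
  assert (L1 := Rmin_l e1 e2). assert (L2 := Rmin_r e1 e2).
  assert (Gy : Gamma s' y) by (apply A1; lra).
  split; auto.
  assert (A3 := Rle_lt_trans _ _ _ (Hdlip _ _) (A2 s' y Gy ltac:(lra) ltac:(lra))).
  apply Rabs_def2 in A3; lra. }
{ intros x Hx; split; [apply (Gamma_0 d Gamma phi Hphi)|].
  rewrite (phi_0 d Gamma phi Hphi); unfold N0 in Hx; lra. }
(* Large enough that [/ K] is at most [t1] and [t2]; the summand 1 serves the Gronwall estimates. *)
set (K := 1 + / t1 + / t2).
assert (HK : 1 <= K /\ / K <= t1 /\ / K <= t2).
{ assert (I1 := Rinv_0_lt_compat _ Ht1). assert (I2 := Rinv_0_lt_compat _ Ht2).
  assert (HK1 : / t1 <= K) by (unfold K; lra). assert (HK2 : / t2 <= K) by (unfold K; lra).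
  split; [unfold K; lra|]; split.
  - rewrite <- (Rinv_inv t1); apply Rinv_le_contravar; auto.
  - rewrite <- (Rinv_inv t2); apply Rinv_le_contravar; auto. }
(* Scaled to reach 1 at depth [c / 2]; it vanishes outside [U]. *)
set (w := fun x => 2 / c * depth d U x).
assert (Hc2 : 0 < 2 / c) by (apply Rdiv_lt_0_compat; lra).
destruct (time_changed_flow d Gamma phi N w (2 / c) K) as
  [theta (Th0 & Thadd & ThN & Thcont & Thorb & Theq & Thfull)]; auto; try apply HK.
{ intros x; apply Rmult_le_pos; [lra|apply depth_nonneg; auto]. }
{ intros x Hx; apply HUN, Hdep. unfold w in Hx.
  apply (Rmult_lt_reg_l (2 / c)); lra. }
{ intros x y; unfold w; rewrite <- Rmult_minus_distr_l, Rabs_mult, (Rabs_right (2 / c)) by lra.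
  apply Rmult_le_compat_l; [lra|auto]. }
{ intros s x Nx Hs; apply H1; auto; lra. }
assert (HP : forall y, N0 y -> forall r, Rabs r <= / K -> Gamma r y /\ 1 <= w (phi r y)).
{ intros y Hy r Hr; destruct (H2 r y Hy ltac:(lra)) as [Gr Hr']; split; auto.
  unfold w; left. replace 1 with (2 / c * (c / 2)) by (field; lra).
  apply Rmult_lt_compat_l; lra. }
(* It inherits the Lipschitz constant 1 from [depth], and [c <= 1] keeps it at most 1. *)
set (g := fun x => Rmax 0 (c - depth d U x)).
assert (Hgb : forall x, 0 <= g x <= 1).
{ intros x; unfold g; split; [apply Rmax_l|]; apply Rmax_lub; [lra|].
  assert (A := depth_nonneg d U x Hd); lra. }
assert (Hgl : forall x y, Rabs (g x - g y) <= d x y).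
{ intros x y; apply Rle_trans with (2 := Hdlip x y); unfold g, Rmax.
  do 2 destruct Rle_dec; unfold Rabs; do 2 destruct Rcase_abs; lra. }
assert (Hg0 : forall x, g x = 0 <-> N0 x).
{ intros x; unfold g, N0, Rmax; destruct Rle_dec; lra. }
set (psi := cone_flow d N Hd theta g ThN Thcont Hgb Hgl).
assert (Em : Rabs (-1) = 1) by (rewrite Rabs_left; lra).
set (alpha := cone_end N (-1) Em). set (omega := cone_end N 1 Rabs_R1).
assert (E0 : Rabs 0 < 1) by (rewrite Rabs_R0; lra).
set (h := fun x => match excluded_middle_informative (N x) with
  | left Nx => cone_point N x 0 Nx E0 | right _ => alpha end).
assert (Hh : forall x, N x -> proj1_sig (h x) = (Some x, 0)).
{ intros x Nx; unfold h; destruct excluded_middle_informative; [reflexivity|contradiction]. }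
(* At level 0 both caps equal 1, so [h] preserves distances up to 1. *)
assert (HhD : forall x x', N x -> N x' -> cone_dist d N (h x) (h x') = Rmin (d x x') 1).
{ intros x x' Nx Nx'; unfold cone_dist, level; rewrite !Hh by auto; simpl.
  rewrite Rminus_0_r, Rabs_R0, Rminus_0_r, (Rmin_left 1 1) by lra; ring. }
assert (Hpsih : forall x t, N x -> theta t x = phi t x -> height d N Hd theta g Thcont Hgb Hgl x 0 t = 0 ->
  h (phi t x) = psi t (h x)).
{ intros x t Nx E1 E2; apply cone_eq.
  rewrite Hh by (rewrite <- E1; apply ThN; auto).
  unfold psi, cone_flow; simpl; rewrite Hh by auto; simpl; rewrite E1, E2; auto. }
set (hL := fun y => exists x, L x /\ h x = y).
destruct (lyapunov_universe (cone_dist d N) psi (level N) hL alpha omega)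
  as (Hfwd & Hbwd & Hrep & Hatt & Hcap).
- apply cone_metric; auto.
- apply cone_compact; auto.
- apply cone_is_flow; auto.
- intros y z; apply level_lip; auto.
- intros y s t; apply level_incr; auto.
- intros y; rewrite cone_dist_end; auto.
  assert (A := level_bound N y); apply Rabs_le_between in A.
  unfold alpha, level at 2; simpl; rewrite Rabs_right; lra.
- intros y; rewrite cone_dist_end; [|auto|apply Rabs_R1].
  assert (A := level_bound N y); apply Rabs_le_between in A.
  unfold omega, level at 2; simpl; rewrite Rabs_left1; lra.
- reflexivity.
- reflexivity.
- intros t; apply cone_flow_end.
- intros t; apply cone_flow_end.
- intros y [x [Lx <-]]; unfold level; rewrite Hh; auto.
- intros y t [x [Lx <-]].
  (* Every [theta]-orbit runs inside a [phi]-orbit, so [L] is invariant under [theta] too. *)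
  assert (HLth : forall s, L (theta s x)).
  { intros s; destruct (Thorb s x) as [r [Gr ->]]; apply Hinv; auto. }
  exists (theta t x); split; auto; apply cone_eq.
  rewrite Hh by auto; unfold psi, cone_flow; simpl; rewrite Hh by auto; simpl.
  rewrite height_zero; auto; intros s _; apply Hg0; auto.
- intros y Hy Hcst; destruct (level_const d N Hd theta g ThN Thcont Hgb Hgl y Hy Hcst)
    as [x [Ey [Nx Hgx]]].
  exists x; split; [|apply cone_eq; rewrite Hh, Ey; auto].
  assert (Hth : forall t, N0 (theta t x)) by (intros t; apply Hg0; auto).
  (* A [theta]-orbit inside [N0] moves at full speed, so it is the complete [phi]-orbit, and it
     stays in [N]. *)
  apply Hiso; intros t _.
  destruct (Thfull x) with t as [_ <-]; [|apply HN0N; auto].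
  intros s; apply HP; auto.
- exists N0, (cone N), (cone_dist d N), psi, h, alpha, omega.
  split; [|split].
  + split; [auto|split].
    * exists (fun x => c < depth d U x); split; [apply Hgt|split; [apply HcL|]].
      intros x Hx; left; auto.
    * intros x Hx; apply Hiso; auto.
  + unfold isolating_universe; fold hL.
    split; [apply cone_metric; auto|]. split; [apply cone_compact; auto|].
    split; [apply cone_is_flow; auto|].
    split; [|split; [|split; [|split; [|split; [|split; [|split; [|split; [|split]]]]]]]].
    * intros x x' Nx Nx' E; apply (f_equal (@proj1_sig _ _)) in E.
      rewrite !Hh in E by auto; congruence.
    * intros x Nx eps He; exists eps; split; auto; intros x' Nx' Hx'.
      rewrite HhD by auto; apply Rle_lt_trans with (2 := Hx'), Rmin_l.
    * intros x Nx eps He; exists (Rmin eps 1); split; [apply Rmin_pos; lra|]; intros x' Nx'.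
      rewrite HhD by auto; unfold Rmin; do 2 destruct Rle_dec; lra.
    * intros x t Nx Ht.
      (* The equality is needed on the whole segment: [g] must vanish along it for the level to
         remain 0. *)
      assert (Hb : forall s, Rmin 0 t <= s <= Rmax 0 t -> theta s x = phi s x).
      { intros s Hs; apply Theq; intros r Hr.
        assert (Hr' : Rmin 0 t <= r <= Rmax 0 t).
        { revert Hs Hr; unfold Rmin, Rmax; repeat destruct Rle_dec; lra. }
        destruct (Ht r Hr'); split; auto. }
      apply Hpsih; auto.
      -- apply Hb; unfold Rmin, Rmax; destruct Rle_dec; lra.
      -- apply height_zero; auto; intros s Hs; rewrite Hb by auto; apply Hg0, Ht; auto.
    * intros E; apply (f_equal (level N)) in E; unfold level in E; simpl in E; lra.
    * intros t; apply cone_flow_end.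
    * intros t; apply cone_flow_end.
    * intros x Nx E; apply (f_equal (@proj1_sig _ _)) in E.
      rewrite Hh in E by auto; discriminate E.
    * intros x Nx E; apply (f_equal (@proj1_sig _ _)) in E.
      rewrite Hh in E by auto; discriminate E.
    * split; assumption.
  + simpl; fold hL; auto.
Qed.
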